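(* Let $(\Omega,\Sigma,\mu)$ be a finite (positive) measure space and write $L^p = L^p(\Omega,\Sigma,\mu)$. Let $1 \le r < \infty$, let $\sigma\subseteq\mathbb{R}$ be a nonempty compact set, and let $T$ be a linear transformation defining real $\mathrm{AC}(\sigma)$ operators $T_r \in B(L^r)$ and $T_\infty \in B(L^\infty)$. Then $T_\infty$ has a $\mathrm{BV}(\sigma)$ functional calculus.
   Context: For a nonempty compact set $\sigma \subseteq \mathbb{R}$, $\mathrm{BV}(\sigma)$ is the Banach algebra (pointwise operations) of all functions $f:\sigma \to \mathbb{C}$ of bounded variation, i.e. with $\mathrm{var}_\sigma f = \sup \sum_{i=1}^n |f(t_i)-f(t_{i-1})| < \infty$ (supremum over all finite increasing sequences $t_0<\dots<t_n$ in $\sigma$), with norm $\|f\|_{\mathrm{BV}(\sigma)} = \sup_{\sigma}|f| + \mathrm{var}_\sigma f$. $\mathrm{AC}(\sigma)$ is the closure in $\mathrm{BV}(\sigma)$ of the (restrictions to $\sigma$ of) polynomials, with the same norm. An operator $T \in B(X)$ on a Banach space $X$ is a real $\mathrm{AC}(\sigma)$ operator if there is a bounded algebra homomorphism $\mathrm{AC}(\sigma) \to B(X)$, $f \mapsto f(T)$ (necessarily unique), sending $1$ to $I$ and $t\mapsto t$ to $T$. It has a $\mathrm{BV}(\sigma)$ functional calculus if there is a norm continuous algebra homomorphism $\Psi: \mathrm{BV}(\sigma) \to B(X)$ with $\Psi(f) = f(T)$ for all $f \in \mathrm{AC}(\sigma)$. A linear transformation $T$, whose domain $\mathrm{Dom}(T)$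 consists of equivalence classes of measurable functions $\Omega \to \mathbb{C}$, defines a bounded operator on $L^p$ if $L^p \subseteq \mathrm{Dom}(T)$ and there is $K_p<\infty$ with $\|Tx\|_p \le K_p\|x\|_p$ for all $x \in L^p$; $T_p \in B(L^p)$ denotes the restriction of $T$ to $L^p$. *)

(* Defs.v *)
From HB Require Import structures.
From mathcomp Require Import all_boot all_order all_algebra.
From mathcomp Require Import generic_quotient complex.
From mathcomp Require Import all_classical all_reals all_analysis.
From mathcomp Require Import ess_sup_inf measurable_realfun.

Set Implicit Arguments.
Unset Strict Implicit.
Unset Printing Implicit Defensive.

Import Order.TTheory GRing.Theory Num.Theory.
Import ComplexField.Normc.
Import numFieldNormedType.Exports.

Local Open Scope classical_set_scope.
Local Open Scope ring_scope.

Section complex_measurable.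
Variable R : realType.

HB.instance Definition _ := isPointed.Build R[i] 0.

Definition ReIm (z : R[i]) : R * R := (complex.Re z, complex.Im z).

(* The sigma-algebra on C is the one pulled back from the product (Borel)
   sigma-algebra of R * R, so that f : T -> C is measurable iff Re f and Im f
   are, see [measurable_complexP]. *)
HB.instance Definition _ := @isMeasurable.Build (preimage_display ReIm) R[i]
  (g_sigma_algebra_preimage ReIm)
  (@measurable0 _ (g_sigma_algebra_preimageType ReIm))
  (@measurableC _ (g_sigma_algebra_preimageType ReIm))
  (@bigcupT_measurable _ (g_sigma_algebra_preimageType ReIm)).

Context d (T : measurableType d).
Implicit Types f g : T -> R[i].

Lemma measurable_complexP f : measurable_fun [set: T] f <->
  measurable_fun [set: T] (fun x => complex.Re (f x)) /\
  measurable_fun [set: T] (fun x => complex.Im (f x)).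
Proof.
have mRI : measurable_fun [set: R[i]] ReIm.
  by move=> _ Y mY; exists Y.
split=> [mf|[mr mi]].
  have h := measurableT_comp mRI mf; split.
  - exact: (measurableT_comp measurable_fst h).
  - exact: (measurableT_comp measurable_snd h).
have h : measurable_fun [set: T] (ReIm \o f) by exact: measurable_fun_pair.
move=> _ _ [B mB <-]; have := h measurableT B mB.
by congr measurable; rewrite !setTI comp_preimage.
Qed.

Lemma measurable_add_complex f g : measurable_fun [set: T] f ->
  measurable_fun [set: T] g -> measurable_fun [set: T] (fun x => f x + g x).
Proof.
move=> /measurable_complexP[rf imf] /measurable_complexP[rg img].
apply/measurable_complexP; split.
- rewrite (_ : (fun _ => _) = (fun x => complex.Re (f x) + complex.Re (g x))).
    exact: measurable_funD.
  by apply/funext => x; case: (f x) (g x) => [a b] [c e].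
- rewrite (_ : (fun _ => _) = (fun x => complex.Im (f x) + complex.Im (g x))).
    exact: measurable_funD.
  by apply/funext => x; case: (f x) (g x) => [a b] [c e].
Qed.

Lemma measurable_mul_complex f g : measurable_fun [set: T] f ->
  measurable_fun [set: T] g -> measurable_fun [set: T] (fun x => f x * g x).
Proof.
move=> /measurable_complexP[rf imf] /measurable_complexP[rg img].
apply/measurable_complexP; split.
- rewrite (_ : (fun _ => _) = (fun x => complex.Re (f x) * complex.Re (g x)
      - complex.Im (f x) * complex.Im (g x))).
    by apply: measurable_funB; exact: measurable_funM.
  by apply/funext => x; case: (f x) (g x) => [a b] [c e].
- rewrite (_ : (fun _ => _) = (fun x => complex.Re (f x) * complex.Im (g x)
      + complex.Im (f x) * complex.Re (g x))).
    by apply: measurable_funD; exact: measurable_funM.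
  by apply/funext => x; case: (f x) (g x) => [a b] [c e].
Qed.

Lemma measurable_normc f : measurable_fun [set: T] f ->
  measurable_fun [set: T] (fun x => normc (f x)).
Proof.
move=> /measurable_complexP[rf imf].
rewrite (_ : (fun _ => _) = (fun x =>
    (complex.Re (f x) ^+ 2 + complex.Im (f x) ^+ 2) `^ (2^-1))).
  apply: (measurableT_comp (measurable_powR _)).
  by apply: measurable_funD; apply: measurable_funX.
apply/funext => x; rewrite powR12_sqrt ?addr_ge0 ?sqr_ge0//.
by case: (f x).
Qed.

End complex_measurable.

Section L0_space.
Context d (T : measurableType d) (R : realType).
Variable mu : {measure set T -> \bar R}.
Local Open Scope quotient_scope.

Definition L0 : Type := {mfun_ mu, T >-> R[i]}.
HB.instance Definition _ := Choice.on L0.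
HB.instance Definition _ := EqQuotient.on L0.
Definition L0_fun (f : L0) : T -> R[i] := repr f.
Coercion L0_fun : L0 >-> Funclass.

Lemma measurable_L0 (f : L0) : measurable_fun [set: T] f.
Proof. exact: measurable_funPT. Qed.

Definition toL0 (f : T -> R[i]) (mf : measurable_fun [set: T] f) : L0 :=
  \pi_L0 (mfun_Sub (mem_set mf)).

Lemma toL0E f (mf : measurable_fun [set: T] f) : toL0 mf = f %[ae mu].
Proof.
have : \pi_L0 (repr (toL0 mf)) = \pi_L0 (mfun_Sub (mem_set mf)) by rewrite reprK.
by move=> /eqmodP /asboolP.
Qed.

Lemma L0_eqP (f g : L0) : f = g <-> (f : T -> R[i]) = g %[ae mu].
Proof.
split=> [->//|fg]; first exact: ae_eq_refl.
by rewrite -(reprK f) -(reprK g); apply/eqmodP/asboolP.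
Qed.

Definition L0_zero : L0 := toL0 (@measurable_cst _ _ T R[i] setT 0).
Definition L0_add (f g : L0) : L0 :=
  toL0 (measurable_add_complex (measurable_L0 f) (measurable_L0 g)).
Definition L0_scale (a : R[i]) (f : L0) : L0 :=
  toL0 (measurable_mul_complex (@measurable_cst _ _ T R[i] setT a)
    (measurable_L0 f)).
Definition L0_opp (f : L0) : L0 := L0_scale (- 1) f.

Let zeroE : L0_zero = cst 0 %[ae mu]. Proof. exact: toL0E. Qed.
Let addE f g : L0_add f g = (fun x => f x + g x) %[ae mu].
Proof. exact: toL0E. Qed.
Let scaleE a f : L0_scale a f = (fun x => a * f x) %[ae mu].
Proof. exact: toL0E. Qed.

Ltac near_L0 := apply/L0_eqP; near=> x => _.

Let addA : associative L0_add.
Proof.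
move=> f g h; near_L0.
rewrite (near (addE f (L0_add g h)) x)// (near (addE g h) x)//.
by rewrite (near (addE (L0_add f g) h) x)// (near (addE f g) x)// addrA.
Unshelve. all: by end_near. Qed.

Let addC : commutative L0_add.
Proof.
move=> f g; near_L0.
by rewrite (near (addE f g) x)// (near (addE g f) x)// addrC.
Unshelve. all: by end_near. Qed.

Let add0 : left_id L0_zero L0_add.
Proof.
move=> f; near_L0.
by rewrite (near (addE L0_zero f) x)// (near zeroE x)// add0r.
Unshelve. all: by end_near. Qed.

Let addN : left_inverse L0_zero L0_opp L0_add.
Proof.
move=> f; near_L0.
rewrite (near (addE (L0_opp f) f) x)// (near (scaleE (- 1) f) x)//.
by rewrite (near zeroE x)// mulN1r addNr.
Unshelve. all: by end_near. Qed.

HB.instance Definition _ := GRing.isZmodule.Build L0 addA addC add0 addN.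

Let scaleA a b f : L0_scale a (L0_scale b f) = L0_scale (a * b) f.
Proof.
near_L0; rewrite (near (scaleE a (L0_scale b f)) x)//.
by rewrite (near (scaleE b f) x)// (near (scaleE (a * b) f) x)// mulrA.
Unshelve. all: by end_near. Qed.

Let scale1 : left_id 1 L0_scale.
Proof.
by move=> f; near_L0; rewrite (near (scaleE 1 f) x)// mul1r.
Unshelve. all: by end_near. Qed.

Let scaleDr : right_distributive L0_scale +%R.
Proof.
move=> a f g; near_L0; rewrite (near (scaleE a (f + g)) x)//.
rewrite (near (addE f g) x)// (near (addE (L0_scale a f) (L0_scale a g)) x)//.
by rewrite (near (scaleE a f) x)// (near (scaleE a g) x)// mulrDr.
Unshelve. all: by end_near. Qed.

Let scaleDl f : {morph L0_scale^~ f : a b / a + b}.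
Proof.
move=> a b; near_L0; rewrite (near (scaleE (a + b) f) x)//.
rewrite (near (addE (L0_scale a f) (L0_scale b f)) x)//.
by rewrite (near (scaleE a f) x)// (near (scaleE b f) x)// mulrDl.
Unshelve. all: by end_near. Qed.

HB.instance Definition _ := GRing.Zmodule_isLmodule.Build R[i] L0
  scaleA scale1 scaleDr scaleDl.

Lemma L0_zeroE : (0 : L0) = cst 0 %[ae mu]. Proof. exact: zeroE. Qed.

Lemma L0_addE (f g : L0) : (f + g : L0) = (fun x => f x + g x) %[ae mu].
Proof. exact: addE. Qed.

Lemma L0_scaleE (a : R[i]) (f : L0) :
  (a *: f : L0) = (fun x => a * f x) %[ae mu].
Proof. exact: scaleE. Qed.

End L0_space.

Section Lp_norm.
Context d (T : measurableType d) (R : realType).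
Variable mu : {measure set T -> \bar R}.
Variables (p : \bar R) (p1 : (1 <= p)%E).

Lemma le_Lnorm_ae (f g : T -> R) :
  measurable_fun [set: T] f -> measurable_fun [set: T] g ->
  (forall x, 0 <= f x) -> {ae mu, forall x, f x <= g x} ->
  ('N[mu]_p[EFin \o f] <= 'N[mu]_p[EFin \o g])%E.
Proof.
move=> mf mg f0 fg; rewrite unlock; case: p p1 => [r r1|_|//].
- have r0 : 0 < r by rewrite (lt_le_trans ltr01).
  apply: gt0_ler_poweR.
  + by rewrite invr_ge0 ltW.
  + by rewrite in_itv/= leey andbT integral_ge0// => x _; exact: poweR_ge0.
  + by rewrite in_itv/= leey andbT integral_ge0// => x _; exact: poweR_ge0.
  apply: ae_ge0_le_integral => //=.
  + apply/measurable_EFinP; apply: (measurableT_comp (measurable_powR _)).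
    exact: measurableT_comp.
  + apply/measurable_EFinP; apply: (measurableT_comp (measurable_powR _)).
    exact: measurableT_comp.
  apply: filterS fg => x fgx _; rewrite lee_fin ge0_ler_powR// ?nnegrE//.
    exact: ltW.
  by rewrite !ger0_norm// (le_trans (f0 x)).
- case: ifPn => // _; apply: le_ess_sup; apply: filterS fg => x /= fgx.
  by rewrite lee_fin !ger0_norm// (le_trans (f0 x)).
Qed.

Definition Lpnorm (f : L0 mu) : \bar R := 'N[mu]_p[EFin \o (fun x => normc (f x))].

Lemma normc_ge0 (z : R[i]) : 0 <= normc z.
Proof. by case: z => a b; rewrite sqrtr_ge0. Qed.

Let mnormc (f : L0 mu) : measurable_fun [set: T] (fun x => normc (f x)).
Proof. exact/measurable_normc/measurable_L0. Qed.

Lemma Lpnorm_ge0 (f : L0 mu) : (0 <= Lpnorm f)%E.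
Proof. exact: Lnorm_ge0. Qed.

Lemma Lpnorm0 : Lpnorm 0 = 0%E.
Proof.
apply/eqP; rewrite eq_le Lpnorm_ge0 andbT.
have <- : ('N[mu]_p[EFin \o cst (0%R : R)] = 0)%E.
  by rewrite Lnorm0// gt_eqF// (lt_le_trans _ p1).
apply: le_Lnorm_ae => //=; first by move=> x; exact: normc_ge0.
by apply: filterS (L0_zeroE mu) => x /(_ Logic.I) ->; rewrite normc0.
Qed.

Lemma ler_LpnormD (f g : L0 mu) : (Lpnorm (f + g)%R <= Lpnorm f + Lpnorm g)%E.
Proof.
have mf := mnormc f; have mg := mnormc g.
apply: (@le_trans _ _
  ('N[mu]_p[EFin \o ((fun x => normc (f x)) + (fun x => normc (g x)))%R])%E);
  last exact: eminkowski.
apply: le_Lnorm_ae => //=.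
- exact: measurable_funD.
- by move=> x; exact: normc_ge0.
- apply: filterS (L0_addE f g) => x /(_ Logic.I) ->.
  exact: le_normcD.
Qed.

Lemma Lnorm_scale (a : R) (f : T -> R) : measurable_fun [set: T] f ->
  (forall x, 0 <= f x) -> 0 <= a ->
  ('N[mu]_p[EFin \o (fun x => a * f x)%R] <= a%:E * 'N[mu]_p[EFin \o f])%E.
Proof.
move=> mf f0 a0; rewrite unlock; case: p p1 => [r r1|_|//].
- have r0 : 0 < r by rewrite (lt_le_trans ltr01).
  rewrite (_ : (\int[mu]_x _ = (a `^ r)%:E * \int[mu]_x (`|(f x)%:E| `^ r))%E).
    rewrite poweRM ?lee_fin ?powR_ge0//; last first.
      by apply: integral_ge0 => x _; exact: poweR_ge0.
    by rewrite poweR_EFin -powRrM mulfV ?gt_eqF// powRr1.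
  rewrite -ge0_integralZl//.
  + apply: eq_integral => x _ /=.
    by rewrite normrM (ger0_norm a0) powRM// EFinM.
  + apply/measurable_EFinP; apply: (measurableT_comp (measurable_powR _)).
    exact: measurableT_comp.
  + by move=> x _; exact: poweR_ge0.
  + by rewrite lee_fin powR_ge0.
- case: ifPn => mu0; last by rewrite mule0.
  rewrite -ess_supZl//; apply: le_ess_sup; apply: nearW => x /=.
  by rewrite normrM (ger0_norm a0) EFinM.
Qed.

Lemma ler_LpnormZ (a : R[i]) (f : L0 mu) :
  (Lpnorm (a *: f)%R <= (normc a)%:E * Lpnorm f)%E.
Proof.
have mf := mnormc f.
apply: (le_trans _ (Lnorm_scale mf _ _)); last 2 first.
- by move=> x; exact: normc_ge0.
- exact: normc_ge0.
apply: le_Lnorm_ae => //=.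
- exact: measurable_funM.
- by move=> x; exact: normc_ge0.
- apply: filterS (L0_scaleE a f) => x /(_ Logic.I) ->.
  by rewrite normcM.
Qed.

Lemma Lpnorm_eq0 (f : L0 mu) : Lpnorm f = 0%E -> f = 0.
Proof.
move=> /Lnorm_eq0_eq0 => /(_ _ (lt_le_trans lte01 p1)).
move=> /(_ ltac:(exact/measurable_EFinP)) f0; apply/L0_eqP.
near=> x => _; rewrite (near (L0_zeroE mu) x)//.
have : (normc (f x))%:E = 0%E by apply: (near f0 x).
by move=> [] /eq0_normc.
Unshelve. all: by end_near. Qed.

End Lp_norm.

Section Lp_space.
Context d (T : measurableType d) (R : realType).
Variable mu : {measure set T -> \bar R}.
Variables (p : \bar R) (p1 : (1 <= p)%E).

(* [p1] only serves to let the algebraic structures below be inferred. *)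
Definition in_Lp (_ : (1 <= p)%E) : {pred L0 mu} :=
  fun f => (Lpnorm p f < +oo)%E.

Let Lp_submod_closed : submod_closed (in_Lp p1).
Proof.
split=> [|a f g]; rewrite !unfold_in; first by rewrite Lpnorm0.
move=> fp gp; apply: (le_lt_trans (ler_LpnormD p1 _ _)).
rewrite lte_add_pinfty//; apply: (le_lt_trans (ler_LpnormZ p1 _ _)).
by rewrite lte_mul_pinfty// ?lee_fin ?normc_ge0.
Qed.

HB.instance Definition _ := GRing.isSubmodClosed.Build _ _ (in_Lp p1)
  Lp_submod_closed.

Record Lp := mkLp { Lp_val :> L0 mu; Lp_valP : Lp_val \in in_Lp p1 }.

HB.instance Definition _ := [isSub for Lp_val].
HB.instance Definition _ := [Choice of Lp by <:].
HB.instance Definition _ := [SubChoice_isSubLmodule of Lp by <:].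

Lemma Lpnorm_fineK (f : Lp) : (fine (Lpnorm p f))%:E = Lpnorm p f.
Proof. by rewrite fineK// ge0_fin_numE ?Lpnorm_ge0//; exact: (Lp_valP f). Qed.

Definition Lp_norm (f : Lp) : R[i] := (fine (Lpnorm p f))%:C%C.

Let Lp_normD (f g : Lp) : Lp_norm (f + g) <= Lp_norm f + Lp_norm g.
Proof.
rewrite /Lp_norm -rmorphD/= lecR -lee_fin EFinD (Lpnorm_fineK (f + g)).
rewrite !Lpnorm_fineK.
exact: (ler_LpnormD p1 f g).
Qed.

Let Lp_normZ_le (a : R[i]) (f : Lp) : Lp_norm (a *: f) <= `|a| * Lp_norm f.
Proof.
rewrite /Lp_norm /Num.norm/= -rmorphM/= lecR -lee_fin EFinM.
rewrite (Lpnorm_fineK (a *: f)) !Lpnorm_fineK.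
exact: (ler_LpnormZ p1 a f).
Qed.

Let Lp_normZ (a : R[i]) (f : Lp) : Lp_norm (a *: f) = `|a| * Lp_norm f.
Proof.
apply/eqP; rewrite eq_le Lp_normZ_le/=.
have [->|a0] := eqVneq a 0.
  by rewrite normr0 mul0r lecR fine_ge0// Lpnorm_ge0.
have := Lp_normZ_le a^-1 (a *: f).
by rewrite scalerA mulVf// scale1r normfV ler_pdivlMl ?normr_gt0.
Qed.

Let Lp_norm_eq0 (f : Lp) : Lp_norm f = 0 -> f = 0.
Proof.
move=> [f0]; apply/val_inj/(Lpnorm_eq0 p1).
by rewrite -Lpnorm_fineK f0.
Qed.

HB.instance Definition _ :=
  Lmodule_isNormed.Build R[i] Lp Lp_normD Lp_normZ Lp_norm_eq0.

End Lp_space.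

Section bounded_operators.
Variables (R : realType) (X : normedModType R[i]).

(* The norm of X takes its values in R[i]; its real part is the norm. *)
Definition opnorm (A : X -> X) : \bar R :=
  ereal_sup [set (complex.Re `|A x|)%:E | x in [set x | `|x| <= 1]].

(* Stated for normed spaces: completeness plays no role in the definitions. *)
Record bounded_op := BoundedOp {
  bop_fun :> {linear X -> X};
  bop_bounded : (opnorm bop_fun < +oo)%E }.

End bounded_operators.

Section BV_AC.
Variables (R : realType) (sigma : set R).
Implicit Types f : sigma -> R[i].

(* t 0 < ... < t n is the increasing sequence; the values of t beyond n are
   irrelevant. *)
Definition variation f : \bar R := ereal_sup [set v | exists n (t : nat -> sigma),
  (forall i, (i < n)%N -> set_val (t i) < set_val (t i.+1)) /\
  v = (\sum_(i < n) normc (f (t i.+1) - f (t i)))%:E].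

Definition supnorm f : \bar R :=
  ereal_sup [set (normc (f t))%:E | t in [set: sigma]].

Definition BVnorm f : \bar R := (supnorm f + variation f)%E.

Definition BV : set (sigma -> R[i]) := [set f | (variation f < +oo)%E].

Definition poly_on (p : {poly R[i]}) : sigma -> R[i] :=
  fun t => p.[(set_val t)%:C%C].

Definition AC : set (sigma -> R[i]) := [set f | BV f /\
  forall e : R, 0 < e -> exists p, (BVnorm (f - poly_on p)%R < e%:E)%E].

End BV_AC.

Section functional_calculus.
Variables (R : realType) (sigma : set R) (X : normedModType R[i]).
Implicit Types (A : set (sigma -> R[i])) (T : bounded_op X).
Implicit Types Phi Psi : (sigma -> R[i]) -> bounded_op X.

(* A homomorphism defined on a subalgebra A of functions is given by a total
   function, whose values outside A are irrelevant. *)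
Definition algebra_hom_on A Phi : Prop :=
  (forall (a : R[i]) f g, A f -> A g ->
     forall x, Phi (a *: f + g) x = a *: Phi f x + Phi g x) /\
  (forall f g, A f -> A g -> forall x, Phi (f * g) x = Phi f (Phi g x)).

Definition AC_functional_calculus T Phi : Prop :=
  [/\ algebra_hom_on (@AC R sigma) Phi,
      exists K : R, forall f, AC f -> (opnorm (Phi f) <= K%:E * BVnorm f)%E,
      forall x, Phi (cst 1) x = x &
      forall x, Phi (fun t => (set_val t)%:C%C) x = T x].

Definition real_AC_operator T : Prop :=
  exists Phi, AC_functional_calculus T Phi.

Definition norm_continuous_on_BV Psi : Prop :=
  forall f, BV f -> forall e : R, 0 < e -> exists2 delta : R, 0 < delta &
    forall g, BV g -> (BVnorm (g - f)%R < delta%:E)%E ->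
      (opnorm (fun x => Psi g x - Psi f x)%R < e%:E)%E.

Definition has_BV_functional_calculus T : Prop :=
  exists Phi Psi, [/\ AC_functional_calculus T Phi,
    algebra_hom_on (@BV R sigma) Psi,
    norm_continuous_on_BV Psi &
    forall f, AC f -> forall x, Psi f x = Phi f x].

End functional_calculus.

Arguments real_AC_operator {R} sigma {X} T.
Arguments has_BV_functional_calculus {R} sigma {X} T.

Section linear_transformations.
Context d (T : measurableType d) (R : realType).
Variable mu : {measure set T -> \bar R}.

Record linear_transformation := LinearTransformation {
  lt_dom : set (L0 mu);
  lt_fun :> L0 mu -> L0 mu;
  lt_dom0 : lt_dom 0;
  lt_domP : forall (a : R[i]) f g, lt_dom f -> lt_dom g -> lt_dom (a *: f + g);
  lt_linear : forall (a : R[i]) f g, lt_dom f -> lt_dom g ->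
    lt_fun (a *: f + g) = a *: lt_fun f + lt_fun g }.

Variable S : linear_transformation.
Variables (p : \bar R) (p1 : (1 <= p)%E).

Definition defines_bounded_op : Prop :=
  (forall f : L0 mu, f \in in_Lp p1 -> lt_dom S f) /\
  exists K : R, forall f : L0 mu, f \in in_Lp p1 ->
    (Lpnorm p (S f) <= K%:E * Lpnorm p f)%E.

Variable Sp : defines_bounded_op.

Let restr_bound : exists2 K : R, 0 <= K &
  forall f : L0 mu, f \in in_Lp p1 -> (Lpnorm p (S f) <= K%:E * Lpnorm p f)%E.
Proof.
have [_ [K SK]] := Sp; exists `|K| => // f fp.
apply: (le_trans (SK _ fp)); apply: lee_wpmul2r; first exact: Lpnorm_ge0.
by rewrite lee_fin ler_norm.
Qed.

Let restr_subproof (f : Lp mu p1) : S f \in in_Lp p1.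
Proof.
have [K K0 SK] := restr_bound; rewrite unfold_in.
apply: (le_lt_trans (SK _ (Lp_valP f))).
by rewrite lte_mul_pinfty ?lee_fin//; exact: (Lp_valP f).
Qed.

Definition Lp_restr_fun (f : Lp mu p1) : Lp mu p1 := mkLp (restr_subproof f).

Let restr_linear : linear Lp_restr_fun.
Proof.
move=> a f g; apply: val_inj => /=.
by rewrite lt_linear//; apply: Sp.1; exact: Lp_valP.
Qed.

HB.instance Definition _ :=
  GRing.isLinear.Build R[i] (Lp mu p1) (Lp mu p1) *:%R Lp_restr_fun restr_linear.

Let restr_opnorm : (opnorm Lp_restr_fun < +oo)%E.
Proof.
have [K K0 SK] := restr_bound.
apply: (@le_lt_trans _ _ K%:E); last exact: ltry.
apply: ge_ereal_sup => _ [f /= f1 <-].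
apply: (@le_trans _ _ (Lpnorm p (Lp_restr_fun f))).
  by rewrite -Lpnorm_fineK; exact: lexx.
apply: (le_trans (SK _ (Lp_valP f))).
rewrite -[leRHS]mule1; apply: lee_wpmul2l; first by rewrite lee_fin.
by rewrite -Lpnorm_fineK lee_fin -lecR.
Qed.

Definition Lp_restriction : bounded_op (Lp mu p1) := BoundedOp restr_opnorm.

End linear_transformations.

(* Main.v *)
From HB Require Import structures.
From mathcomp Require Import all_boot all_order all_algebra.
From mathcomp Require Import complex ring lra.
From mathcomp Require Import all_classical all_reals all_analysis.
From mathcomp Require Import ess_sup_inf measurable_realfun.
Require Import Defs.

Set Implicit Arguments.
Unset Strict Implicit.
Unset Printing Implicit Defensive.

Import Order.TTheory GRing.Theory Num.Theory.
Import ComplexField.Normc.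
Import numFieldNormedType.Exports.

Local Open Scope classical_set_scope.
Local Open Scope ring_scope.

#[local] Arguments normc : simpl never.

(** The functional calculus of the operator on L^oo is bounded for two norms at
once: for the norm of L^oo, and for that of L^r, because it agrees with the
calculus on L^r for polynomials and hence, by density, on all of AC(sigma)
([Linf_calculus_Lr_bound]).  What makes this useful is that the balls of L^oo
behave, for the norm of L^r, like those of a reflexive space: given a sequence
bounded in L^oo, the convex hulls of its tails contain vectors that converge in
L^r to an element of L^oo satisfying the same bound ([Linf_mazur]).  To see
this, minimise the square integral over the hulls; the parallelogram law makes
suitable near-minimisers a fast Cauchy sequence, which converges almost
everywhere, and dominated convergence gives convergence in L^r.

From there on measure theory plays no part: [BV_extension] concerns a vector
space with a strong norm B and a weak norm N that are linked by this Mazur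
property, and a representation of AC(sigma) that is bounded for both.

The central estimate is [flat_near_small]: for a vector x and e > 0 there is a
finite set P of points of sigma such that N(h(T)x) <= e var(h) for every h in
AC(sigma) vanishing in a neighbourhood of P.  Close to a single point c, and on
one side of it, take ramps k_n, absolutely continuous, that increase to the
indicator function of that side, with k_m k_n = k_n for m > n.  The Mazur
property, applied to k_n(T)x, yields y with k_n(T)y = k_n(T)x for all n that is
approximated by combinations of the k_n(T)x.  If h lives near c on that side but
vanishes near c, then h = h k_m for some m, so that h(T)x = h(T)y, whereas h(T)
kills a given combination as soon as h lives close enough to c
([monotone_sequence_small]).  A supremum argument along sigma glues the local
estimates: h vanishes where it is cut, so the variations of its pieces add up to
at most that of h ([rvar_cut]).

For f in BV(sigma), call g in AC(sigma) an approximant of f on a finite set P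
when g is constant, equal to f(p), in a neighbourhood of each p in P.  Sums of
ramps provide approximants with norm at most twice that of f
([AC_interpolation]).  Two approximants on P differ by a function that vanishes
near P, so by the central estimate g(T)x converges, as P grows, along all
bounded families of approximants; the limit is f(T)x.  Sums and products of
approximants are approximants of sums and products, so f |-> f(T) is an algebra
homomorphism.  It extends the given one: this is clear for constants; the
function t |-> t has approximants close to it in the norm of BV
([id_flattening]); polynomials and then all of AC(sigma) follow.

Ramps are in AC(sigma) because |t - a| is the limit of polynomials in the norm of
BV, not only uniformly ([ACr_abs]). *)

(** * Variation along lists and the norm of BV *)
Section complex_modulus.
Variable R : realType.
Implicit Types z w : R[i].

Lemma normc_le_add z w : normc (z + w) <= normc z + normc w.
Proof. exact: (@le_normcD R z w). Qed.

Lemma normc_opp z : normc (- z) = normc z.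
Proof. exact: (@normcN R z). Qed.

Lemma normc_distC z w : normc (z - w) = normc (w - z).
Proof. by rewrite -normc_opp opprB. Qed.

Lemma normc_real (a : R) : normc a%:C%C = `|a|.
Proof. by rewrite /normc/= expr0n/= addr0 sqrtr_sqr. Qed.

End complex_modulus.

Section variation_along_lists.
Variables (R : realType) (sigma : set R).
Implicit Types (f g : sigma -> R[i]) (x y c : sigma) (l : seq sigma).

Definition lts x y : bool := set_val x < set_val y.

(** Lists of points are easier to cut and to concatenate than the indexed
    sequences over which the variation is a supremum. *)
Fixpoint listvar f x l : R :=
  if l is y :: l' then normc (f y - f x) + listvar f y l' else 0.

Lemma listvar_cat f x l1 l2 :
  listvar f x (l1 ++ l2) = listvar f x l1 + listvar f (last x l1) l2.
Proof. by elim: l1 x => /= [x|y l IH x]; rewrite ?add0r// IH addrA. Qed.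

Lemma listvar_lin (a : R[i]) f g x l :
  listvar (a *: f + g) x l <= normc a * listvar f x l + listvar g x l.
Proof.
elim: l x => /= [x|y l IH x]; first by rewrite mulr0 addr0.
rewrite mulrDr addrACA lerD// -normcM.
by apply: le_trans (normc_le_add _ _); rewrite mulrBr addrACA -opprD.
Qed.

Lemma listvar_mul (A B : R) f g x l :
  (forall t, normc (f t) <= A) -> (forall t, normc (g t) <= B) ->
  listvar (f * g) x l <= A * listvar g x l + B * listvar f x l.
Proof.
move=> fA gB; elim: l x => /= [x|y l IH x]; first by rewrite !mulr0 addr0.
rewrite !mulrDr addrACA lerD//.
have -> : (f * g) y - (f * g) x = f y * (g y - g x) + g x * (f y - f x).
  by rewrite !fctE; ring.
apply: (le_trans (normc_le_add _ _)).
by rewrite !normcM lerD// ler_wpM2r ?normc_ge0.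
Qed.

Lemma listvar_nth d f x l : listvar f x l =
  \sum_(i < size l) normc (f (nth d (x :: l) i.+1) - f (nth d (x :: l) i)).
Proof.
by elim: l x => [x|y l IH x] /=; rewrite ?big_ord0// big_ord_recl IH.
Qed.

Lemma listvar_le_variation f x l :
  path lts x l -> ((listvar f x l)%:E <= variation f)%E.
Proof.
move=> xl; apply: ereal_sup_ubound; exists (size l), (nth x (x :: l)).
by split; [move=> i il; have /(pathP x) := xl; exact|rewrite -listvar_nth].
Qed.

Lemma variation_le f (B : R) :
  (forall x l, path lts x l -> listvar f x l <= B) -> (variation f <= B%:E)%E.
Proof.
move=> fB; apply: ge_ereal_sup => _ [n [t [tinc ->]]]; rewrite lee_fin.
have sz : size [seq t i | i <- iota 1 n] = n by rewrite size_map size_iota.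
have tE i : (i <= n)%N -> nth (t 0) (t 0 :: [seq t i | i <- iota 1 n]) i = t i.
  case: i => // i ni /=.
  by rewrite (nth_map 0)// ?size_iota// nth_iota.
have /fB : path lts (t 0) [seq t i | i <- iota 1 n].
  apply/(pathP (t 0)) => i; rewrite sz => ni.
  rewrite (tE i (ltnW ni)); have /= -> := tE i.+1 ni.
  exact: tinc.
apply: le_trans; rewrite (listvar_nth (t 0)) sz le_eqVlt; apply/orP; left.
by apply/eqP/eq_bigr => i _; rewrite !tE// ltnW.
Qed.

(** A list that jumps over [c] is made to stop at [c]: as [h] vanishes there,
    this does not change the jump of the truncated function. *)
Lemma listvar_lt_cut h c x l : h c = 0 -> path lts x l -> lts x c ->
  exists l', [/\ path lts x l', last x l' = c &
    listvar (fun t => if lts t c then h t else 0) x l <= listvar h x l'].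
Proof.
move=> hc; elim: l x => [x _ xc|y l IH x /= /andP[xy yl] xc].
  by exists [:: c] => /=; rewrite xc; split=> //; rewrite addr0 normc_ge0.
have [yc|/negbTE yc] := boolP (lts y c).
  have [l' [p1 p2 p3]] := IH _ yl yc; exists (y :: l'); split=> //=.
    by rewrite xy.
  by rewrite xc lerD2l.
exists [:: c] => /=; rewrite xc hc addr0; split=> //.
rewrite -[leRHS]addr0 lerD2l.
have {}yc : set_val c <= set_val y by move: yc; rewrite /lts ltNge => /negbFE.
elim: l y {IH xy} yc yl => //= z l IH y yc /andP[yz zl].
have zc : set_val c <= set_val z by exact: le_trans yc (ltW yz).
rewrite /lts !ltNge yc zc/= subr0 normc0 add0r.
exact: IH.
Qed.

(** Dually, a list that reaches the right of [c] is made to start at [c]. *)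
Lemma listvar_ge_cut h c x l : h c = 0 -> path lts x l ->
  exists2 l', path lts c l' &
    listvar (fun t => if lts t c then 0 else h t) x l <= listvar h c l'.
Proof.
move=> hc.
have geF y : set_val c <= set_val y -> lts y c = false.
  by rewrite /lts ltNge => ->.
have ge y l' : set_val c <= set_val y -> path lts y l' ->
    listvar (fun t => if lts t c then 0 else h t) y l' = listvar h y l'.
  elim: l' y => //= z l' IH y yc /andP[yz zl].
  have zc : set_val c <= set_val z by exact: le_trans yc (ltW yz).
  by rewrite !geF// IH.
have ins y l' : set_val c <= set_val y -> path lts y l' ->
    exists2 l2, path lts c l2 & normc (h y - 0) + listvar h y l' <= listvar h c l2.
  rewrite le_eqVlt => /orP[/eqP/val_inj <-{y} cl|cy yl].
    by exists l' => //; rewrite hc subr0 normc0 add0r.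
  by exists (y :: l') => /=; [rewrite yl andbT|rewrite hc].
elim: l x => [x _|y l IH x]; first by exists [::].
move=> /= /andP[xy yl].
have [xc|xc] := ltP (set_val x) (set_val c).
  have -> : lts x c = true by exact: xc.
  have [yc|yc] := ltP (set_val y) (set_val c).
    have -> : lts y c = true by exact: yc.
    by rewrite subr0 normc0 add0r; exact: IH.
  by rewrite geF// ge//; exact: ins.
have yc : set_val c <= set_val y by exact: le_trans xc (ltW xy).
rewrite !geF// ge//.
have xyl : path lts x (y :: l) by rewrite /= yl andbT.
have [l2 cl2 le2] := ins _ _ xc xyl; exists l2 => //.
by apply: le_trans le2; rewrite /= lerDr normc_ge0.
Qed.

End variation_along_lists.
Arguments lts {R sigma}.

Section real_BV_norm.
Variables (R : realType) (sigma : set R).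
Hypothesis sigma0 : sigma !=set0.
Implicit Types (f g h : sigma -> R[i]) (x t c : sigma) (l : seq sigma).

(** The norms of the theory are extended real numbers, finite on functions of
    bounded variation; the estimates are carried out on their real values. *)
Definition rvar f : R := fine (variation f).
Definition rsup f : R := fine (supnorm f).
Definition rBV f : R := rsup f + rvar f.

Definition some_point : sigma := exist _ (projT1 (cid sigma0)) (mem_set (projT2 (cid sigma0))).

Lemma variation_ge0 f : (0 <= variation f)%E.
Proof. exact: (@listvar_le_variation _ _ f some_point [::]). Qed.

Lemma variationE f : BV f -> variation f = (rvar f)%:E.
Proof. by move=> bf; rewrite /rvar fineK// ge0_fin_numE ?variation_ge0. Qed.

Lemma rvar_ge0 f : 0 <= rvar f.
Proof. by rewrite fine_ge0// variation_ge0. Qed.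

Lemma listvar_le_rvar f x l : BV f -> path lts x l -> listvar f x l <= rvar f.
Proof.
by move=> bf xl; rewrite -lee_fin -variationE//; exact: listvar_le_variation.
Qed.

Lemma rvar_le f (B : R) :
  (forall x l, path lts x l -> listvar f x l <= B) -> BV f /\ rvar f <= B.
Proof.
move=> /variation_le fB.
have bf : BV f by apply: le_lt_trans fB _; exact: ltry.
by split=> //; rewrite -lee_fin -variationE.
Qed.

Lemma dist_le_rvar f x t : BV f -> normc (f t - f x) <= rvar f.
Proof.
move=> bf; wlog xt : x t / set_val x <= set_val t.
  move=> H; have [/H//|/ltW/H] := leP (set_val x) (set_val t).
  by rewrite normc_distC.
move: xt; rewrite le_eqVlt => /orP[/eqP/val_inj ->|xt].
  by rewrite subrr normc0 rvar_ge0.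
by have := @listvar_le_rvar f x [:: t] bf; rewrite /= andbT addr0; apply.
Qed.

Lemma supnorm_ge0 f : (0 <= supnorm f)%E.
Proof.
apply: (@le_trans _ _ (normc (f some_point))%:E).
  by rewrite lee_fin normc_ge0.
by apply: ereal_sup_ubound; exists some_point.
Qed.

Lemma supnorm_le f (B : R) : (forall t, normc (f t) <= B) -> (supnorm f <= B%:E)%E.
Proof. by move=> fB; apply: ge_ereal_sup => _ [t _ <-]; rewrite lee_fin. Qed.

Lemma supnormE f : BV f -> supnorm f = (rsup f)%:E.
Proof.
move=> bf; rewrite /rsup fineK// ge0_fin_numE ?supnorm_ge0//.
apply: (@le_lt_trans _ _ (normc (f some_point) + rvar f)%:E); last exact: ltry.
apply: supnorm_le => t; rewrite -[f t](subrK (f some_point)) addrC.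
by apply: (le_trans (normc_le_add _ _)); rewrite lerD2l dist_le_rvar.
Qed.

Lemma rsup_ge0 f : 0 <= rsup f.
Proof. by rewrite fine_ge0// supnorm_ge0. Qed.

Lemma normc_le_rsup f t : BV f -> normc (f t) <= rsup f.
Proof.
by move=> bf; rewrite -lee_fin -supnormE//; apply: ereal_sup_ubound; exists t.
Qed.

Lemma rsup_le f (B : R) : BV f -> (forall t, normc (f t) <= B) -> rsup f <= B.
Proof. by move=> bf /supnorm_le; rewrite supnormE. Qed.

Lemma BVnormE f : BV f -> BVnorm f = (rBV f)%:E.
Proof. by move=> bf; rewrite /BVnorm supnormE// variationE// EFinD. Qed.

Lemma rBV_ge0 f : 0 <= rBV f.
Proof. by rewrite addr_ge0 ?rsup_ge0 ?rvar_ge0. Qed.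

Lemma rvar_le_rBV f : rvar f <= rBV f.
Proof. by rewrite lerDr rsup_ge0. Qed.

Lemma BVnorm_lt f (e : R) : (BVnorm f < e%:E)%E -> BV f /\ rBV f < e.
Proof.
move=> fe; have bf : BV f.
  apply: le_lt_trans (lt_trans fe (ltry _)).
  by rewrite /BVnorm leeDr// supnorm_ge0.
by split=> //; rewrite -lte_fin -BVnormE.
Qed.

Lemma rBV_le f (A B : R) : (forall t, normc (f t) <= A) ->
  (forall x l, path lts x l -> listvar f x l <= B) -> BV f /\ rBV f <= A + B.
Proof.
by move=> fA /rvar_le[bf fB]; split=> //; rewrite lerD// rsup_le.
Qed.

Lemma BV_lin (a : R[i]) f g : BV f -> BV g ->
  BV (a *: f + g) /\ rBV (a *: f + g) <= normc a * rBV f + rBV g.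
Proof.
move=> bf bg; rewrite /rBV mulrDr addrACA; apply: rBV_le => [t|x l xl].
  apply: (le_trans (normc_le_add _ _)); rewrite normcM.
  by rewrite lerD ?normc_le_rsup// ler_wpM2l ?normc_ge0// normc_le_rsup.
apply: (le_trans (listvar_lin _ _ _ _ _)).
by rewrite lerD ?listvar_le_rvar// ler_wpM2l ?normc_ge0// listvar_le_rvar.
Qed.

Lemma BV_mul f g : BV f -> BV g ->
  BV (f * g) /\ rBV (f * g) <= rBV f * rBV g.
Proof.
move=> bf bg.
have [||b le] := @rBV_le (f * g) (rsup f * rsup g)
  (rsup f * rvar g + rsup g * rvar f).
- by move=> t; rewrite fctE normcM ler_pM ?normc_ge0 ?normc_le_rsup.
- move=> x l xl; apply: (le_trans (listvar_mul _ _ _ _)) => [t|t|].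
  + exact: normc_le_rsup.
  + exact: normc_le_rsup.
  + by rewrite lerD// ler_wpM2l ?rsup_ge0 ?listvar_le_rvar.
split=> //; apply: (le_trans le); rewrite /rBV.
have := mulr_ge0 (rvar_ge0 f) (rvar_ge0 g).
lra.
Qed.

End real_BV_norm.

(** * The algebra of absolutely continuous functions *)
Section AC_algebra.
Variables (R : realType) (sigma : set R).
Hypothesis sigma0 : sigma !=set0.
Variables (M : R) (sigma_le : forall t : sigma, `|set_val t| <= M).
Implicit Types (f g h : sigma -> R[i]) (s t c x : sigma).

Definition realf (g : R -> R) : sigma -> R[i] := fun t => (g (set_val t))%:C%C.

Lemma realfB_normc (g : R -> R) t x :
  normc (realf g t - realf g x) = `|g (set_val t) - g (set_val x)|.
Proof. by rewrite /realf -rmorphB/= normc_real. Qed.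

Lemma listvar_nondecreasing (g : R -> R) x l :
  (forall s t, set_val s <= set_val t -> g (set_val s) <= g (set_val t)) -> path lts x l ->
  listvar (realf g) x l = g (set_val (last x l)) - g (set_val x).
Proof.
move=> gmono; elim: l x => /= [x|y l IH x /andP[xy yl]]; first by rewrite subrr.
rewrite IH// realfB_normc ger0_norm; first by rewrite addrC addrA subrK.
by rewrite subr_ge0 gmono// ltW.
Qed.

Lemma listvarN f x l : listvar (- f) x l = listvar f x l.
Proof.
elim: l x => //= y l IH x; rewrite IH; congr (_ + _).
by rewrite -normc_opp opprB opprK addrC.
Qed.

Lemma BV_nondecreasing (g : R -> R) (B : R) :
  (forall s t, set_val s <= set_val t -> g (set_val s) <= g (set_val t)) ->
  (forall t, 0 <= g (set_val t) <= B) ->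
  BV (realf g) /\ rBV (realf g) <= B + B.
Proof.
move=> gmono gB.
apply: rBV_le => // [t|x l xl].
  by have /andP[g0 gt] := gB t; rewrite /realf normc_real ger0_norm.
rewrite listvar_nondecreasing//.
by have /andP[g0 _] := gB x; have /andP[_ g1] := gB (last x l); lra.
Qed.

Lemma BV_nonincreasing (g : R -> R) (B : R) :
  (forall s t, set_val s <= set_val t -> g (set_val t) <= g (set_val s)) ->
  (forall t, 0 <= g (set_val t) <= B) ->
  BV (realf g) /\ rBV (realf g) <= B + B.
Proof.
move=> gmono gB.
apply: rBV_le => // [t|x l xl].
  by have /andP[g0 gt] := gB t; rewrite /realf normc_real ger0_norm.
rewrite -listvarN (_ : - realf g = realf (fun a => - g a)); last first.
  by apply/funext => t; rewrite /realf fctE -rmorphN.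
rewrite listvar_nondecreasing//; last first.
  by move=> s t st; rewrite lerN2; exact: gmono.
by have /andP[_ g0] := gB x; have /andP[g1 _] := gB (last x l); lra.
Qed.

Lemma BV_cst (a : R[i]) : BV (cst a : sigma -> R[i]) /\ rBV (cst a : sigma -> R[i]) <= normc a.
Proof.
rewrite -[leRHS]addr0; apply: rBV_le => // x l _.
by elim: l x => //= y l IH x; rewrite subrr normc0 add0r.
Qed.

Lemma BV_id : BV (realf id).
Proof.
have [s t st||b _] := @BV_nondecreasing (fun a => a + M) (M + M).
- by rewrite lerD2r.
- move=> t; have := sigma_le t.
  by rewrite ler_norml => /andP[? ?]; apply/andP; split; lra.
- have -> : realf id = 1 *: realf (fun a => a + M) + cst (- M)%:C%C.
    by apply/funext => t; rewrite /realf !fctE scale1r -rmorphD/= addrK.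
  exact: (BV_lin sigma0 1 b (BV_cst _).1).1.
Qed.

Lemma poly_onX : poly_on 'X = realf id.
Proof. by apply/funext => t; rewrite /poly_on hornerX. Qed.

Lemma poly_on_lin (a : R[i]) p q :
  poly_on (a *: p + q) = a *: poly_on p + poly_on q :> (sigma -> R[i]).
Proof. by apply/funext => t; rewrite /poly_on hornerD hornerZ. Qed.

Lemma poly_onM p q : poly_on (p * q) = poly_on p * poly_on q :> (sigma -> R[i]).
Proof. by apply/funext => t; rewrite /poly_on hornerM. Qed.

Lemma poly_onC a : poly_on a%:P = cst a :> (sigma -> R[i]).
Proof. by apply/funext => t; rewrite /poly_on hornerC. Qed.

Lemma BV_poly p : BV (poly_on p : sigma -> R[i]).
Proof.
elim/poly_ind: p => [|p a IH]; first by rewrite poly_onC; exact: (BV_cst _).1.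
rewrite -[p * 'X]scale1r poly_on_lin poly_onM poly_onC poly_onX.
by apply: (BV_lin sigma0 _ _ _).1; [exact: (BV_mul sigma0 IH BV_id).1|exact: (BV_cst _).1].
Qed.

Lemma BV_sub f g : BV f -> BV g -> BV (f - g) /\ rBV (f - g) <= rBV f + rBV g.
Proof.
move=> bf bg; have := BV_lin sigma0 (- 1) bg bf.
by rewrite normc_opp normc1 mul1r scaleN1r addrC [rBV f + _]addrC.
Qed.

Lemma AC_BV f : AC f -> BV f. Proof. by case. Qed.

Lemma AC_approx f (e : R) : AC f -> 0 < e ->
  exists2 p, BV (f - poly_on p) & rBV (f - poly_on p) < e.
Proof. by move=> [_ /[apply]] [p /(BVnorm_lt sigma0)[]]; exists p. Qed.

Lemma AC_poly p : AC (poly_on p : sigma -> R[i]).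
Proof.
split=> [|e e0]; first exact: BV_poly.
exists p; rewrite subrr BVnormE//; last exact: (BV_cst 0).1.
by rewrite lte_fin; apply: le_lt_trans (BV_cst 0).2 _; rewrite normc0.
Qed.

Lemma AC_cst (a : R[i]) : AC (cst a : sigma -> R[i]).
Proof. by rewrite -poly_onC; exact: AC_poly. Qed.

Lemma AC_closed f : (forall e : R, 0 < e ->
  exists g, [/\ AC g, BV (f - g) & rBV (f - g) < e]) -> AC f.
Proof.
move=> fAC; split.
  have [g [[bg _] bfg _]] := fAC 1 ltr01.
  by rewrite -(subrK g f) -[f - g]scale1r; exact: (BV_lin sigma0 _ _ _).1.
move=> e e0; have [g [ag bfg fge]] := fAC (e / 2) ltac:(lra).
have [p bgp gpe] := AC_approx ag (e := e / 2) ltac:(lra).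
exists p; have [] := BV_lin sigma0 1 bfg bgp.
rewrite scale1r addrA subrK normc1 mul1r => b le.
by rewrite BVnormE// lte_fin (le_lt_trans le)//; lra.
Qed.

Lemma AC_lin (a : R[i]) f g : AC f -> AC g -> AC (a *: f + g).
Proof.
move=> af ag; apply: AC_closed => e e0.
have a0 : 0 < normc a + 1 by rewrite ltr_wpDl// normc_ge0.
have e20 : 0 < e / 2 by lra.
have [p bp pe] := AC_approx af (divr_gt0 e20 a0).
have [q bq qe] := AC_approx ag (e := e / 2) ltac:(lra).
exists (poly_on (a *: p + q)); split; first exact: AC_poly.
  all: rewrite poly_on_lin opprD addrACA -scalerBr.
  exact: (BV_lin sigma0 _ bp bq).1.
apply: le_lt_trans (BV_lin sigma0 _ bp bq).2 _.
move: pe; rewrite ltr_pdivlMr// mulrDr mulr1 mulrC.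
have := rBV_ge0 sigma0 (f - poly_on p); lra.
Qed.

Lemma AC_mulpoly f p : AC f -> AC (f * poly_on p).
Proof.
move=> af; apply: AC_closed => e e0.
have p0 : 0 < rBV (poly_on p : sigma -> R[i]) + 1 by rewrite ltr_wpDl// rBV_ge0.
have [q bq qe] := AC_approx af (divr_gt0 e0 p0).
exists (poly_on (q * p)); split; first exact: AC_poly.
  all: rewrite poly_onM -mulrBl.
  exact: (BV_mul sigma0 bq (BV_poly p)).1.
apply: le_lt_trans (BV_mul sigma0 bq (BV_poly p)).2 _.
move: qe; rewrite ltr_pdivlMr// mulrDr mulr1.
by apply: le_lt_trans; rewrite lerDl rBV_ge0.
Qed.

Lemma AC_mul f g : AC f -> AC g -> AC (f * g).
Proof.
move=> af ag; apply: AC_closed => e e0; have bf := AC_BV af.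
have f0 : 0 < rBV f + 1 by rewrite ltr_wpDl// rBV_ge0.
have [q bq qe] := AC_approx ag (divr_gt0 e0 f0).
exists (f * poly_on q); split; first exact: AC_mulpoly.
  all: rewrite -mulrBr.
  exact: (BV_mul sigma0 bf bq).1.
apply: le_lt_trans (BV_mul sigma0 bf bq).2 _.
move: qe; rewrite ltr_pdivlMr// mulrDr mulr1 mulrC.
by apply: le_lt_trans; rewrite lerDl rBV_ge0.
Qed.

Lemma AC_sub f g : AC f -> AC g -> AC (f - g).
Proof. by move=> af ag; rewrite addrC -scaleN1r; exact: AC_lin. Qed.

End AC_algebra.

(** * The modulus is a limit of polynomials in the norm of BV *)
Section square_root_iteration.
Variable R : realType.

(** The fixed point of the iteration in [0, 1] is [1 - `|w|], since
    [1 - w] solves [y = (1 - w ^+ 2 + y ^+ 2) / 2]. *)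
Fixpoint sqrt_iter (n : nat) (w : R) : R :=
  if n is m.+1 then (1 - w ^+ 2 + sqrt_iter m w ^+ 2) / 2 else 0.

(** Each step multiplies the error [1 - w - y] by [(1 - w + y) / 2].  Both factors
    are nonnegative and nonincreasing in [w], hence so is the new error, whose
    variation on [0, 1] is then at most its value at [0]. *)
Lemma sqrt_iter_mono n (v w : R) : 0 <= v -> v <= w -> w <= 1 ->
  [/\ 0 <= sqrt_iter n w, sqrt_iter n w <= sqrt_iter n v,
    0 <= 1 - w - sqrt_iter n w &
    1 - w - sqrt_iter n w <= 1 - v - sqrt_iter n v].
Proof.
move=> v0 vw w1; elim: n => /= [|n [IH1 IH2 IH3 IH4]]; first by split; lra.
set a := sqrt_iter n w in IH1 IH2 IH3 IH4 *.
set b := sqrt_iter n v in IH1 IH2 IH3 IH4 *.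
have E (x y : R) : 1 - x - (1 - x ^+ 2 + y ^+ 2) / 2 = (1 - x - y) * ((1 - x + y) / 2).
  by field.
by rewrite !E; split; rewrite ?mulr_ge0 ?ler_pM//; nra.
Qed.

Lemma sqrt_iter0_le1 n : 0 <= sqrt_iter n 0 <= 1.
Proof.
have [] := @sqrt_iter_mono n 0 0 (lexx 0) (lexx 0) ler01.
by rewrite subr0 subr_ge0 => -> _ ->.
Qed.

(** At [0] the error [e] becomes [e * (1 - e / 2)], whence a decay in [1 / n]. *)
Lemma sqrt_iter0 n : 1 - sqrt_iter n 0 <= 2 / n.+2%:R.
Proof.
elim: n => /= [|n]; first by rewrite subr0 divff.
have /andP[] := sqrt_iter0_le1 n; move: (sqrt_iter n 0) => a a0 a1.
rewrite expr0n/= subr0 !ler_pdivlMr ?ltr0n// -[n.+3]addn1 natrD.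
move: (n.+2%:R) (ltr0n R n.+2) => k /= k0 H.
nra.
Qed.

Lemma sqrt_iter_normr n (w : R) : sqrt_iter n `|w| = sqrt_iter n w.
Proof. by elim: n => //= n ->; rewrite real_normK// num_real. Qed.

End square_root_iteration.


Section ramps.
Variables (R : realType) (sigma : set R).
Hypothesis sigma0 : sigma !=set0.
Variables (M : R) (sigma_le : forall t : sigma, `|set_val t| <= M).
Implicit Types (f g h : sigma -> R[i]) (c x y : sigma).

Lemma realf_lin (k : R) (g h : R -> R) :
  realf (fun t => k * g t + h t) = k%:C%C *: realf g + realf h :> (sigma -> R[i]).
Proof. by apply/funext => x; rewrite /realf !fctE rmorphD rmorphM. Qed.

Lemma realf_mul (g h : R -> R) :
  realf (fun t => g t * h t) = realf g * realf h :> (sigma -> R[i]).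
Proof. by apply/funext => x; rewrite /realf !fctE rmorphM. Qed.

Lemma eq_realf (g h : R -> R) : (forall x, g (set_val x) = h (set_val x)) ->
  realf g = realf h :> (sigma -> R[i]).
Proof. by move=> gh; apply/funext => x; rewrite /realf gh. Qed.

Definition ACr (g : R -> R) : Prop := AC (realf g : sigma -> R[i]).

Lemma ACr_cst (k : R) : ACr (fun=> k).
Proof. exact: (AC_cst sigma0 sigma_le k%:C%C). Qed.

Lemma ACr_id : ACr id.
Proof. by rewrite /ACr -poly_onX; exact: (AC_poly sigma0 sigma_le). Qed.

Lemma ACr_lin (k : R) (g h : R -> R) : ACr g -> ACr h ->
  ACr (fun t => k * g t + h t).
Proof. by rewrite /ACr realf_lin; exact: (AC_lin sigma0 sigma_le). Qed.

Lemma ACr_mul (g h : R -> R) : ACr g -> ACr h -> ACr (fun t => g t * h t).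
Proof. by rewrite /ACr realf_mul; exact: (AC_mul sigma0 sigma_le). Qed.

Lemma ACr_sqrt_iter n (g : R -> R) : ACr g -> ACr (fun t => sqrt_iter n (g t)).
Proof.
move=> ag; elim: n => [|n IH]; first exact: ACr_cst.
rewrite [X in ACr X](_ : _ = (fun t => (- 2^-1) * (g t * g t) + (2^-1 *
  (sqrt_iter n (g t) * sqrt_iter n (g t)) + 2^-1))); last first.
  by apply/funext => t /=; field.
apply: ACr_lin; first exact: ACr_mul.
by apply: ACr_lin; [exact: ACr_mul|exact: ACr_cst].
Qed.

(** After rescaling [sigma] into [-1, 1], the error of [1 - sqrt_iter n z] is an even
    function of [z] that is monotone in [`|z|].  It is therefore a sum of two
    monotone functions and a constant, and its BV norm is controlled by its
    value at [0]. *)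
Lemma ACr_abs (a : R) : ACr (fun t => `|t - a|).
Proof.
have M_ge0 : 0 <= M := le_trans (normr_ge0 _) (sigma_le (some_point sigma0)).
pose L := M + `|a| + 1.
have L0 : 0 < L by rewrite /L; have := normr_ge0 a; lra.
pose z t := (t - a) / L.
have z1 x : `|z (set_val x)| <= 1.
  rewrite normrM [`|L^-1|]gtr0_norm ?invr_gt0// ler_pdivrMr// mul1r.
  by apply: le_trans (ler_normB _ _) _; have := sigma_le x; rewrite /L; lra.
have az : ACr z.
  rewrite [X in ACr X](_ : _ = (fun t => L^-1 * t + (- a / L))).
    exact: ACr_lin ACr_id (ACr_cst _).
  by apply/funext => t; rewrite /z mulrBl mulNr mulrC.
apply: (AC_closed sigma0) => e e0.
(* Five terms of size at most [L * D 0], with [D 0 <= 2 / n.+2]. *)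
have [n ne] : exists n : nat, L * 10 / n.+2%:R < e.
  exists (Num.trunc (L * 10 / e)).
  have LE : 0 <= L * 10 / e by rewrite divr_ge0 ?ltW// mulr_gt0.
  rewrite ltr_pdivrMr// -ltr_pdivrMl// mulrC.
  apply: lt_trans (truncnS_gt _) _.
  by rewrite ltr_nat.
pose D (w : R) := 1 - w - sqrt_iter n w.
have D0 : D 0 <= 2 / n.+2%:R by rewrite /D subr0 sqrt_iter0.
have D_mono (v w : R) : 0 <= v -> v <= w -> w <= 1 -> 0 <= D w <= D v.
  by move=> v0 vw w1; have [_ _ h1 h2] := sqrt_iter_mono n v0 vw w1; rewrite /D h1 h2.
have z_mono x y : set_val x <= set_val y -> z (set_val x) <= z (set_val y).
  by move=> xy; rewrite /z ler_pM2r ?invr_gt0// lerD2r.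
have z11 x : - 1 <= z (set_val x) <= 1 by rewrite -ler_norml.
have max1 x : Num.max (z (set_val x)) 0 <= 1.
  by rewrite ge_max ler01 andbT; have /andP[] := z11 x.
have max2 x : Num.max (- z (set_val x)) 0 <= 1.
  by rewrite ge_max ler01 andbT lerNl; have /andP[] := z11 x.
have le0max w : 0 <= Num.max w (0 : R) by rewrite le_max lexx orbT.
have [||b1 n1] := @BV_nonincreasing R sigma sigma0 (fun t => D (Num.max (z t) 0)) (D 0).
- move=> x y xy; apply: (andP (D_mono _ _ _ _ _)).2 => //.
  by rewrite ge_max !le_max z_mono ?lexx ?orbT.
- by move=> x; apply: D_mono.
have [||b2 n2] := @BV_nondecreasing R sigma sigma0 (fun t => D (Num.max (- z t) 0)) (D 0).
- move=> x y xy; apply: (andP (D_mono _ _ _ _ _)).2 => //.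
  by rewrite ge_max !le_max lerN2 z_mono ?lexx ?orbT.
- by move=> x; apply: D_mono.
have Dsplit x : D `|z (set_val x)| =
    D (Num.max (z (set_val x)) 0) + D (Num.max (- z (set_val x)) 0) - D 0.
  case: (ger0P (z (set_val x))) => z0.
    by rewrite [Num.max (- _) _]max_r ?oppr_le0// addrK.
  by rewrite max_l ?oppr_ge0 ?ltW// addrC addKr.
exists (realf (fun t => L * (1 - sqrt_iter n (z t)))).
have E : realf (fun t => `|t - a|) - realf (fun t => L * (1 - sqrt_iter n (z t))) =
   (- L)%:C%C *: (1 *: realf (fun t => D (Num.max (z t) 0)) +
   realf (fun t => D (Num.max (- z t) 0))) + cst (L * D 0)%:C%C :> (sigma -> R[i]).
  have -> : cst (L * D 0)%:C%C = realf (fun=> L * D 0) by [].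
  rewrite -(realf_lin 1) -(realf_lin (- L)); apply/funext => x.
  rewrite /realf !fctE -!rmorphB/=; congr (_%:C)%C.
  have -> : `|set_val x - a| = L * `|z (set_val x)|.
    by rewrite /z normrM [`|L^-1|]gtr0_norm ?invr_gt0// mulrC divfK ?gt_eqF.
  rewrite [1 * _ + _](_ : _ = D `|z (set_val x)| + D 0); last first.
    by rewrite Dsplit mul1r subrK.
  by rewrite {1}/D sqrt_iter_normr; ring.
have [b3 n3] := BV_lin sigma0 1 b1 b2.
have [b4 n4] := BV_lin sigma0 (- L)%:C%C b3 (BV_cst sigma0 (L * D 0)%:C%C).1.
split.
- rewrite (@eq_realf _ (fun t => - L * sqrt_iter n (z t) + L)).
    exact: ACr_lin (ACr_sqrt_iter _ az) (ACr_cst _).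
  by move=> x; rewrite mulrBr mulr1 addrC mulNr.
- by rewrite E.
rewrite E; apply: le_lt_trans n4 (le_lt_trans _ ne).
have := (BV_cst sigma0 (L * D 0)%:C%C).2.
have D00 : 0 <= D 0 by have /andP[] := D_mono 0 0 (lexx 0) (lexx 0) ler01.
rewrite !normc_real normrN (gtr0_norm L0) (ger0_norm (mulr_ge0 (ltW L0) D00)).
move: n3; rewrite normc1 mul1r => n3 n5.
have -> : L * 10 / n.+2%:R = L * (2 / n.+2%:R) * 5 by move: (n.+2%:R^-1) => k; ring.
set v3 := rBV (1 *: _ + _) in n3 *; set v4 := rBV (cst _) in n5 *.
set v1 := rBV _ in n1 n3; set v2 := rBV _ in n2 n3.
clearbody v1 v2 v3 v4; have {n1 n2 n3} : v3 <= 4 * D 0 by lra.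
move: D0 n5; move: (D 0) (2 / _) => d k dk n5 n3.
have := ler_wpM2l (ltW L0) n3; have := ler_wpM2l (ltW L0) dk; lra.
Qed.

End ramps.

(** * Ramps: cutting, interpolating and flattening *)
Section ramp_function.
Variable R : realType.
Implicit Types u v s t : R.

Definition ramp u v t := (`|t - u| - `|t - v| + (v - u)) / (2 * (v - u)).

Lemma ramp_le u v t : u < v -> t <= u -> ramp u v t = 0.
Proof.
move=> uv tu; rewrite /ramp !ler0_norm ?subr_le0//; last exact: le_trans (ltW uv).
by rewrite (_ : _ + _ = 0) ?mul0r//; ring.
Qed.

Lemma ramp_mid u v t : u < v -> u <= t -> t <= v -> ramp u v t = (t - u) / (v - u).
Proof.
move=> uv ut tv; rewrite /ramp ger0_norm ?subr_ge0// ler0_norm ?subr_le0//.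
by field; rewrite subr_eq0 gt_eqF.
Qed.

Lemma ramp_ge u v t : u < v -> v <= t -> ramp u v t = 1.
Proof.
move=> uv vt; rewrite /ramp !ger0_norm ?subr_ge0//; last exact: le_trans (ltW uv) _.
by field; rewrite subr_eq0 gt_eqF.
Qed.

Lemma ramp_mono u v s t : u < v -> s <= t -> ramp u v s <= ramp u v t.
Proof.
move=> uv st; rewrite /ramp ler_pM2r ?invr_gt0 ?mulr_gt0 ?subr_gt0// lerD2r.
case: (lerP u s) => us; case: (lerP u t) => ut; case: (lerP v s) => vs;
  case: (lerP v t) => vt; try lra.
all: rewrite ?(ger0_norm (_ : 0 <= s - u)) ?(ger0_norm (_ : 0 <= t - u))
  ?(ger0_norm (_ : 0 <= s - v)) ?(ger0_norm (_ : 0 <= t - v))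
  ?(ler0_norm (_ : s - u <= 0)) ?(ler0_norm (_ : t - u <= 0))
  ?(ler0_norm (_ : s - v <= 0)) ?(ler0_norm (_ : t - v <= 0)); lra.
Qed.

Lemma ramp01 u v t : u < v -> 0 <= ramp u v t <= 1.
Proof.
move=> uv; rewrite -(@ramp_le u v (Num.min t u))// ?ge_min ?lexx ?orbT//.
rewrite -[1](@ramp_ge u v (Num.max t v))// ?le_max ?lexx ?orbT//.
by rewrite !ramp_mono// ?ge_min ?le_max lexx.
Qed.

End ramp_function.

Section cutting_and_interpolating.
Variables (R : realType) (sigma : set R).
Hypothesis sigma0 : sigma !=set0.
Variables (M : R) (sigma_le : forall t : sigma, `|set_val t| <= M).
Implicit Types (f g h : sigma -> R[i]) (c p t x y : sigma) (P : seq sigma).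

Lemma ACr_ramp (u v : R) : ACr sigma (ramp u v).
Proof.
have aa := ACr_abs sigma0 sigma_le.
rewrite /ramp [X in ACr _ X](_ : _ = (fun t : R => (2 * (v - u))^-1 * `|t - u| +
   ((- (2 * (v - u))^-1) * `|t - v| + (v - u) / (2 * (v - u))))).
  apply: (ACr_lin sigma0 sigma_le); first exact: aa.
  apply: (ACr_lin sigma0 sigma_le); first exact: aa.
  exact: (ACr_cst sigma0 sigma_le).
by apply/funext => t; ring.
Qed.

Lemma rBV_ramp (u v : R) : u < v -> rBV (realf (ramp u v) : sigma -> R[i]) <= 2.
Proof.
move=> uv; apply: (@BV_nondecreasing R sigma sigma0 (ramp u v) 1 _ _).2.
  by move=> x y; exact: ramp_mono.
by move=> x; exact: ramp01.
Qed.

Definition flat_near f (a : R[i]) p : Prop := exists2 eta : R, 0 < eta &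
  forall t, `|set_val t - set_val p| < eta -> f t = a.

Lemma flat_near_at f a p : flat_near f a p -> f p = a.
Proof. by move=> [eta eta0]; apply; rewrite subrr normr0. Qed.

Lemma flat_near_lin (k : R[i]) f g a b p :
  flat_near f a p -> flat_near g b p -> flat_near (k *: f + g) (k * a + b) p.
Proof.
move=> [e e0 fe] [e' e'0 ge]; exists (Num.min e e'); first by rewrite lt_min e0.
by move=> t; rewrite lt_min => /andP[te te']; rewrite !fctE fe// ge.
Qed.

Lemma flat_near_mul f g a b p :
  flat_near f a p -> flat_near g b p -> flat_near (f * g) (a * b) p.
Proof.
move=> [e e0 fe] [e' e'0 ge]; exists (Num.min e e'); first by rewrite lt_min e0.
by move=> t; rewrite lt_min => /andP[te te']; rewrite !fctE fe// ge.
Qed.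

Lemma flat_near_sub f g a b p :
  flat_near f a p -> flat_near g b p -> flat_near (f - g) (a - b) p.
Proof.
move=> fa gb; have := flat_near_lin (- 1) gb fa.
by rewrite scaleN1r mulN1r ![- _ + _]addrC.
Qed.

(** Cutting at [c] amounts to multiplying by a ramp that rises where [h]
    vanishes. *)
Lemma AC_cut_ge h c : AC h -> flat_near h 0 c ->
  AC (fun t => if lts t c then 0 else h t).
Proof.
move=> ah [eta eta0 heta].
have uv : set_val c - eta < set_val c by rewrite ltrBlDr ltrDl.
suff -> : (fun t => if lts t c then 0 else h t) =
    h * realf (ramp (set_val c - eta) (set_val c)).
  by apply: (AC_mul sigma0 sigma_le ah); exact: ACr_ramp.
apply/funext => t; rewrite fctE /realf; case: ifPn => [tc|].
  have [tce|tce] := leP (set_val t) (set_val c - eta).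
    by rewrite ramp_le// mulr0.
  rewrite heta ?mul0r// ltr_norml; move: tc; rewrite /lts => tc.
  by apply/andP; split; lra.
by rewrite /lts -leNgt => ct; rewrite ramp_ge// mulr1.
Qed.

Lemma AC_cut_lt h c : AC h -> flat_near h 0 c ->
  AC (fun t => if lts t c then h t else 0).
Proof.
move=> ah hc.
suff -> : (fun t => if lts t c then h t else 0) =
    h - (fun t => if lts t c then 0 else h t).
  by apply: AC_sub => //; exact: AC_cut_ge.
by apply/funext => t; rewrite !fctE; case: ifP; rewrite ?subr0 ?subrr.
Qed.

(** Two lists that estimate the variations of the pieces can be made to end,
    respectively to start, at the zero [c], and are then concatenated. *)
Lemma rvar_cut h c : BV h -> h c = 0 ->
  rvar (fun t => if lts t c then h t else 0) +
  rvar (fun t => if lts t c then 0 else h t) <= rvar h.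
Proof.
move=> bh hc; rewrite addrC -lerBrDr.
apply: (@rvar_le R sigma sigma0 _ _ _).2 => x2 l2 p2.
rewrite lerBrDl -lerBrDr.
apply: (@rvar_le R sigma sigma0 _ _ _).2 => x1 l1 p1.
rewrite lerBrDr.
have [l2' cl2 le2] := listvar_ge_cut hc p2.
have [x1c|x1c] := ltP (set_val x1) (set_val c).
  have [l1' [cl1 lastl1 le1]] := listvar_lt_cut hc p1 x1c.
  apply: (le_trans (lerD le1 le2)); rewrite -lastl1 -listvar_cat.
  by apply: listvar_le_rvar => //; rewrite cat_path cl1 lastl1.
rewrite [X in X + _](_ : _ = 0).
  by rewrite add0r; apply: le_trans le2 (listvar_le_rvar _ _ _).
elim: l1 x1 p1 x1c => //= y l1 IH x1 /andP[xy p1] cx.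
have cy : set_val c <= set_val y by exact: le_trans cx (ltW xy).
by rewrite /lts !ltNge cx cy/= subrr normc0 add0r; exact: IH.
Qed.

Lemma sorted_superlist P : exists x l, path lts x l /\ {subset P <= x :: l}.
Proof.
pose Q := some_point sigma0 :: P.
pose s := sort (relpre set_val <=%R) (undup Q).
have : sorted lts s.
  rewrite -[sorted _ _]/(sorted (relpre set_val <%R) s) -sorted_map /s -sort_map.
  by rewrite sort_lt_sorted map_inj_uniq ?undup_uniq//; exact: val_inj.
have Qs p : p \in P -> p \in s.
  by move=> pP; rewrite mem_sort mem_undup inE pP orbT.
have : some_point sigma0 \in s by rewrite mem_sort mem_undup inE eqxx.
by case: s Qs => // x l Ps _ xl; exists x, l.
Qed.

(** The interpolant is constant near the points and passes from one value to the
    next along a ramp.  That it is constant to the left of the first point is what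
    allows a further ramp to be added there. *)
Lemma AC_interpolation_path f x l : path lts x l -> exists g,
  [/\ AC g, forall p, p \in x :: l -> flat_near g (f p) p,
    forall t, set_val t <= set_val x -> g t = f x &
    rBV (g - cst (f x)) <= 2 * listvar f x l].
Proof.
elim: l x => [|y l IH] x /=.
  exists (cst (f x)); split=> //; first exact: (AC_cst sigma0 sigma_le).
    by move=> p; rewrite inE => /eqP ->; exists 1.
  by rewrite subrr mulr0 (le_trans (BV_cst sigma0 0).2)// normc0.
move=> /andP[xy yl]; have [g [ag gP gy gl]] := IH y yl.
rewrite /lts in xy.
pose u := (set_val x *+ 2 + set_val y) / 3.
pose v := (set_val x + set_val y *+ 2) / 3.
have [xu uv vy] : [/\ set_val x < u, u < v & v < set_val y].
  by rewrite /u /v !mulr2n; split; lra.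
pose k := f y - f x.
pose r : sigma -> R[i] := realf (ramp u v).
have ar : AC r := ACr_ramp u v.
have ac (a : R[i]) : AC (cst a : sigma -> R[i]) := AC_cst sigma0 sigma_le a.
have gE t : (k *: r + (1 *: g + cst (- k))) t = k * r t + (g t - k).
  by rewrite !fctE scale1r.
have rlt t : set_val t <= u -> r t = 0.
  by move=> tu; rewrite /r /realf ramp_le.
have rge t : v <= set_val t -> r t = 1.
  by move=> tv; rewrite /r /realf ramp_ge.
have glow t : set_val t <= u -> (k *: r + (1 *: g + cst (- k))) t = f x.
  move=> tu; rewrite gE rlt// mulr0 add0r gy; last by rewrite (le_trans tu) ?ltW// (lt_trans uv).
  by rewrite /k opprB addrC subrK.
exists (k *: r + (1 *: g + cst (- k))); split.
- by do 2!apply: (AC_lin sigma0 sigma_le) => //.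
- move=> p; rewrite inE => /orP[/eqP ->|pyl].
    exists (u - set_val x); rewrite ?subr_gt0// => t.
    by rewrite ltr_norml => /andP[_]; rewrite ltrD2r => /ltW; exact: glow.
  have [e e0 ge] := gP p pyl.
  exists (Num.min e (set_val y - v)); first by rewrite lt_min e0 subr_gt0.
  have yp : set_val y <= set_val p.
    move: pyl; rewrite inE => /orP[/eqP ->//|pl].
    have : all (lts y) l by apply: order_path_min yl => ? ? ?; exact: lt_trans.
    by move=> /allP/(_ _ pl)/ltW.
  move=> t; rewrite lt_min => /andP[te]; rewrite ltr_norml => /andP[tp _].
  by rewrite gE rge ?mulr1 ?ge// 1?addrC ?subrK//; lra.
- by move=> t tx; apply: glow; rewrite (le_trans tx) ?ltW.
have -> : k *: r + (1 *: g + cst (- k)) - cst (f x) = k *: r + (g - cst (f y)).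
  by apply/funext => t; rewrite !fctE scale1r /k; ring.
apply: le_trans (BV_lin sigma0 _ (AC_BV ar) (AC_BV (AC_sub sigma0 sigma_le ag (ac _)))).2 _.
rewrite [leRHS]mulrDr lerD// mulrC ler_wpM2r ?normc_ge0//; exact: rBV_ramp.
Qed.

Lemma AC_interpolation f P : BV f -> exists g,
  [/\ AC g, forall p, p \in P -> flat_near g (f p) p & rBV g <= 2 * rBV f].
Proof.
move=> bf; have [x [l [xl Pxl]]] := sorted_superlist P.
have [g [ag gP _ gl]] := AC_interpolation_path f xl.
exists g; split=> // [p /Pxl|]; first exact: gP.
have ac := AC_cst sigma0 sigma_le (f x).
have bgx := AC_BV (AC_sub sigma0 sigma_le ag ac).
have := (BV_lin sigma0 1 bgx (AC_BV ac)).2.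
rewrite scale1r subrK normc1 mul1r => /le_trans; apply.
apply: le_trans (lerD gl (BV_cst sigma0 _).2) _.
have := normc_le_rsup sigma0 x bf; have := listvar_le_rvar sigma0 bf xl.
have := rsup_ge0 sigma0 f; rewrite /rBV; lra.
Qed.

(** A function equal to [t - p] near [p] and to [0] at distance [2 * delta], with
    BV norm of order [delta]; written as a combination of ramps. *)
Definition tent (p delta t : R) : R :=
  - delta * ramp (p - 2 * delta) (p - delta) t +
  (2 * delta * ramp (p - delta) (p + delta) t +
  (- delta * ramp (p + delta) (p + 2 * delta) t + 0)).

Lemma tent_far (p delta t : R) : 0 < delta -> 2 * delta <= `|t - p| -> tent p delta t = 0.
Proof.
move=> d0; rewrite ler_normr => /orP[tp|tp].
  by rewrite /tent !ramp_ge; lra.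
by rewrite /tent !ramp_le; lra.
Qed.

Lemma tent_near (p delta t : R) : 0 < delta -> `|t - p| < delta -> tent p delta t = t - p.
Proof.
move=> d0; rewrite ltr_norml => /andP[t1 t2].
rewrite /tent ramp_ge 1?ramp_mid 1?ramp_le; try lra.
by field; lra.
Qed.

Lemma AC_tent (p delta : R) : 0 < delta ->
  ACr sigma (tent p delta) /\ rBV (realf (tent p delta) : sigma -> R[i]) <= 8 * delta.
Proof.
move=> d0; split.
  do 3!(apply: (ACr_lin sigma0 sigma_le); first exact: ACr_ramp).
  exact: (ACr_cst sigma0 sigma_le).
have b3 := BV_lin sigma0 (- delta)%:C%C (AC_BV (ACr_ramp (p + delta) (p + 2 * delta))) (BV_cst sigma0 0).1.
have b2 := BV_lin sigma0 (2 * delta)%:C%C (AC_BV (ACr_ramp (p - delta) (p + delta))) b3.1.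
have b1 := BV_lin sigma0 (- delta)%:C%C (AC_BV (ACr_ramp (p - 2 * delta) (p - delta))) b2.1.
have -> : realf (tent p delta) = (- delta)%:C%C *: realf (ramp (p - 2 * delta) (p - delta)) +
  ((2 * delta)%:C%C *: realf (ramp (p - delta) (p + delta)) + ((- delta)%:C%C *:
  realf (ramp (p + delta) (p + 2 * delta)) + cst 0)) :> (sigma -> R[i]).
  have -> : (cst 0 : sigma -> R[i]) = realf (fun=> 0) by [].
  by rewrite -!realf_lin.
move: b1.2 b2.2 b3.2 (BV_cst sigma0 0).2.
rewrite normc0 !normc_real normrN (gtr0_norm d0) gtr0_norm ?mulr_gt0//.
have := ler_wpM2l (ltW d0) (@rBV_ramp (p - 2 * delta) (p - delta) ltac:(lra)).
have := ler_wpM2l (ltW d0) (@rBV_ramp (p - delta) (p + delta) ltac:(lra)).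
have := ler_wpM2l (ltW d0) (@rBV_ramp (p + delta) (p + 2 * delta) ltac:(lra)).
lra.
Qed.

Lemma separated_from p P : p \notin P ->
  exists2 d : R, 0 < d & forall q, q \in P -> d <= `|set_val q - set_val p|.
Proof.
elim: P => [_|q P IH]; first by exists 1.
rewrite inE negb_or => /andP[pq /IH[d d0 dP]].
have qp0 : 0 < `|set_val q - set_val p|.
  by rewrite normr_gt0 subr_eq0 eq_sym; apply: contra pq => /eqP/val_inj ->.
exists (Num.min d `|set_val q - set_val p|); first by rewrite lt_min d0.
move=> q'; rewrite inE => /orP[/eqP ->|/dP]; first by rewrite ge_min lexx orbT.
by rewrite ge_min => ->.
Qed.

(** A small tent is subtracted at each point of [P].  The third clause serves the
    induction: a new point keeps away from the tents already in place. *)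
Lemma id_flattening P (e : R) : 0 < e -> exists g,
  [/\ AC g, forall p, p \in P -> flat_near g (set_val p)%:C%C p,
    forall t, (forall p, p \in P -> e <= `|set_val t - set_val p|) ->
      g t = (set_val t)%:C%C & rBV (realf id - g) <= e].
Proof.
elim: P e => [|p P IH] e e0.
  exists (realf id); split=> //; first exact: (ACr_id sigma0 sigma_le).
  by rewrite subrr (le_trans (BV_cst sigma0 0).2)// normc0 ltW.
have [pP|pP] := boolP (p \in P).
  have [g [ag gP gt ge]] := IH e e0; exists g; split=> //.
    by move=> q; rewrite inE => /orP[/eqP ->|]; exact: gP.
  by move=> t tP; apply: gt => q qP; apply: tP; rewrite inE qP orbT.
have [d d0 dP] := separated_from pP.
pose e' := Num.min (e / 2) (d / 2).
have e'0 : 0 < e' by rewrite lt_min !divr_gt0.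
have [g [ag gP gt ge]] := IH e' e'0.
pose delta := Num.min (e / 16) (d / 4).
have delta0 : 0 < delta by rewrite lt_min !divr_gt0.
have [de dd] : delta <= e / 16 /\ delta <= d / 4.
  by rewrite /delta !ge_min !lexx orbT.
have [ee ed] : e' <= e / 2 /\ e' <= d / 2 by rewrite /e' !ge_min !lexx orbT.
have [at_ bt] := AC_tent (set_val p) delta0.
exists (g - realf (tent (set_val p) delta)); split.
- exact: (AC_sub sigma0 sigma_le).
- move=> q; rewrite inE => /orP[/eqP ->|qP].
    exists delta => // t tp; rewrite !fctE gt => [|q' qP].
      by rewrite /realf tent_near// -rmorphB/= opprB addrC subrK.
    have := dP q' qP; have := ler_distD (set_val t) (set_val q') (set_val p).
    rewrite (distrC (set_val q') (set_val t)); lra.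
  have [eta eta0 geta] := gP q qP.
  exists (Num.min eta (d / 2)); first by rewrite lt_min eta0 divr_gt0.
  move=> t; rewrite lt_min => /andP[teta td]; rewrite !fctE geta// /realf.
  rewrite tent_far ?subr0//.
  have := dP q qP; have := ler_distD (set_val t) (set_val q) (set_val p).
  rewrite (distrC (set_val q) (set_val t)); lra.
- move=> t tP; rewrite !fctE gt ?/realf ?tent_far ?subr0//.
    by apply: le_trans (tP p _); [lra|rewrite inE eqxx].
  move=> q qP; apply: le_trans (tP q _); first lra.
  by rewrite inE qP orbT.
have ai := ACr_id sigma0 sigma_le.
rewrite opprB addrCA -[realf (tent _ _)]scale1r.
have bg := AC_BV (AC_sub sigma0 sigma_le ai ag).
apply: le_trans (BV_lin sigma0 1 (AC_BV at_) bg).2 _.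
rewrite normc1; lra.
Qed.

End cutting_and_interpolating.

(** * Extension of a functional calculus from AC to BV *)
Section midpoint_hulls.
Variables (R : realType) (X : lmodType R[i]).

Definition midpoint_closed (C : set X) : Prop :=
  forall u v, C u -> C v -> C (2^-1 *: (u + v)).

Lemma midpoint_id (v : X) : 2^-1 *: (v + v) = v.
Proof.
rewrite -{1 2}[v]scale1r -scalerDl scalerA (_ : _ * _ = 1) ?scale1r//.
by apply: mulVf; rewrite pnatr_eq0.
Qed.

(** An intersection of sets closed under midpoints, instead of explicit convex
    combinations: a property of the [x m] passes to the hull as soon as it is
    stable under midpoints, and midpoints are all that the parallelogram law
    requires. *)
Definition tail_hull (x : nat -> X) (n : nat) : set X :=
  [set y | forall C, midpoint_closed C -> (forall m, (n <= m)%N -> C (x m)) -> C y].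

(** The form of Mazur's lemma that replaces the weak compactness of [B]-balls for
    the norm [N]. *)
Definition mazur_property (B N : X -> R) : Prop :=
  forall (b : R) (x : nat -> X), (forall n, B (x n) <= b) ->
  exists2 y, B y <= b &
    forall n (e : R), 0 < e -> exists2 y', tail_hull x n y' & N (y' - y) < e.

End midpoint_hulls.

Section extension.
Variables (R : realType) (sigma : set R).
Hypothesis sigma0 : sigma !=set0.
Variables (M : R) (sigma_le : forall t : sigma, `|set_val t| <= M).
Hypothesis sigma_closed : closed sigma.
Variables (X : lmodType R[i]) (B N : X -> R).
Hypothesis N_add : forall x y, N (x + y) <= N x + N y.
Hypothesis N_scale : forall (a : R[i]) x, N (a *: x) = normc a * N x.
Hypothesis N_eq0 : forall x, N x = 0 -> x = 0.
Hypothesis mazur : mazur_property B N.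
Variables (Phi : (sigma -> R[i]) -> {linear X -> X}) (K : R).
Hypothesis K_ge0 : 0 <= K.
Hypothesis Phi_lin : forall (a : R[i]) f g, AC f -> AC g ->
  forall x, Phi (a *: f + g) x = a *: Phi f x + Phi g x.
Hypothesis Phi_mul : forall f g, AC f -> AC g ->
  forall x, Phi (f * g) x = Phi f (Phi g x).
Hypothesis Phi_N : forall f, AC f -> forall x, N (Phi f x) <= K * rBV f * N x.
Hypothesis Phi_B : forall f, AC f -> forall x, B (Phi f x) <= K * rBV f * B x.
Implicit Types (f g h : sigma -> R[i]) (x y z : X) (c p t : sigma) (P : seq sigma).

Let acS f g := @AC_sub _ _ sigma0 M sigma_le f g.
Let acM f g := @AC_mul _ _ sigma0 M sigma_le f g.

Let N0 : N 0 = 0.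
Proof. by rewrite -(scale0r (0 : X)) N_scale normc0 mul0r. Qed.

Let N_opp x : N (- x) = N x.
Proof. by rewrite -scaleN1r N_scale normc_opp normc1 mul1r. Qed.

Let N_ge0 x : 0 <= N x.
Proof. by have := N_add x (- x); rewrite subrr N0 N_opp; lra. Qed.

Let N_distC x y : N (x - y) = N (y - x).
Proof. by rewrite -N_opp opprB. Qed.

Let N_dist x y z : N (x - z) <= N (x - y) + N (y - z).
Proof. by have := N_add (x - y) (y - z); rewrite addrA subrK. Qed.

Let N_mid x y : N (2^-1 *: (x + y)) <= (N x + N y) / 2.
Proof.
rewrite N_scale mulrC (_ : normc _ = 2^-1); last first.
  by rewrite normcV (_ : 2 = (2 : R)%:C%C) ?normc_real ?ger0_norm// rmorphD.
by rewrite ler_pM2r// invr_gt0.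
Qed.

Let N_small x : (forall e : R, 0 < e -> N x <= e) -> x = 0.
Proof.
move=> xe; apply: N_eq0; apply/eqP; rewrite eq_le N_ge0 andbT.
by apply/ler_addgt0Pr => e e0; rewrite add0r xe.
Qed.

Let Phi_sub f g x : AC f -> AC g -> Phi (f - g) x = Phi f x - Phi g x.
Proof.
move=> af ag; have -> : f - g = (- 1) *: g + f by rewrite scaleN1r addrC.
by rewrite Phi_lin// scaleN1r addrC.
Qed.

Let Phi_0 x : Phi 0 x = 0.
Proof. by rewrite -(subrr (cst 1)) Phi_sub ?subrr//; exact: (AC_cst sigma0 sigma_le). Qed.

(** The Mazur limit [y] of [Phi (k n) x] has the same image as [x] under every
    [Phi (k j)], because [k j * k m = k j] for large [m].  Hence [Phi h x = Phi h y]
    if [h = h * k m] for some [m]; and [Phi h] annihilates the combination of the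
    [Phi (k i) x] that approximates [y] when [h * k n = 0] for a large [n]. *)
Lemma monotone_sequence_small (k : nat -> sigma -> R[i]) (b : R) x (e : R) :
  (forall n, AC (k n)) -> (forall n, rBV (k n) <= b) ->
  (forall m n, (n < m)%N -> k m * k n = k n) -> 0 < e ->
  exists n, forall h, AC h -> h * k n = 0 -> (exists m, h * k m = h) ->
    N (Phi h x) <= e * rBV h.
Proof.
move=> ak kb kk e0.
have b0 : 0 <= b := le_trans (rBV_ge0 sigma0 _) (kb 0%N).
have [n|y _ ylim] := @mazur (K * b * `|B x|) (fun n => Phi (k n) x).
  apply: (le_trans (Phi_B (ak n) x)).
  apply: (@le_trans _ _ (K * rBV (k n) * `|B x|)).
    by rewrite ler_wpM2l ?ler_norm// mulr_ge0// rBV_ge0.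
  by rewrite ler_wpM2r// ler_wpM2l.
(* The [k j] do not see the difference of [x] and the limit [y]. *)
have kxy j : Phi (k j) y = Phi (k j) x.
  apply/eqP; rewrite -subr_eq0; apply/eqP/N_small => d d0.
  have Kb : 0 < K * b + 1 by rewrite ltr_wpDl// mulr_ge0.
  have [y' hy' y'y] := ylim j.+1 (d / (K * b + 1)) (divr_gt0 d0 Kb).
  have <- : Phi (k j) y' = Phi (k j) x.
    apply: (hy' [set z | Phi (k j) z = Phi (k j) x]) => [u v /= hu hv|m jm] /=.
      by rewrite linearZ linearD/= hu hv midpoint_id.
    by rewrite -Phi_mul// mulrC kk.
  rewrite N_distC -linearB; apply: le_trans (Phi_N (ak j) _) _.
  move: y'y; rewrite ltr_pdivlMr// mulrDr mulr1 => y'y.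
  apply: (@le_trans _ _ (K * b * N (y' - y))); first by rewrite ler_wpM2r// ler_wpM2l.
  have := N_ge0 (y' - y); lra.
have K1 : 0 < K + 1 by rewrite ltr_wpDl.
have [y' hy' y'y] := ylim 0%N (e / (K + 1)) (divr_gt0 e0 K1).
have [n hn] : exists n, forall h, AC h -> h * k n = 0 -> Phi h y' = 0.
  apply: (hy' [set z | exists n, forall h, AC h -> h * k n = 0 -> Phi h z = 0]).
    move=> u v /= [n1 h1] [n2 h2]; exists (maxn n1 n2).+1 => h ah hk.
    have hk' i : (i <= maxn n1 n2)%N -> h * k i = 0.
      by move=> iM; rewrite -(kk (maxn n1 n2).+1 i)// mulrA hk mul0r.
    by rewrite linearZ linearD/= h1 ?h2 ?addr0 ?scaler0// hk' ?leq_maxl ?leq_maxr.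
  move=> m _ /=; exists m => h ah hk.
  by rewrite -Phi_mul// hk Phi_0.
exists n => h ah hk [m hm].
have -> : Phi h x = Phi h (y - y').
  by rewrite linearB/= (hn h)// subr0 -hm !Phi_mul// kxy.
apply: le_trans (Phi_N ah _) _.
move: y'y; rewrite N_distC ltr_pdivlMr// mulrDr mulr1 => y'y.
rewrite mulrAC ler_wpM2r ?rBV_ge0//; have := N_ge0 (y - y'); lra.
Qed.

Let d (n : nat) : R := n.+1%:R^-1.
Let d_gt0 n : 0 < d n. Proof. by rewrite invr_gt0 ltr0n. Qed.
Let d_le m n : (n <= m)%N -> d m <= d n.
Proof. by move=> nm; rewrite lef_pV2 ?posrE ?ltr0n// ler_nat. Qed.
Let d_lt n : d n.+1 < d n.
Proof. by rewrite ltf_pV2 ?posrE ?ltr0n// ltr_nat. Qed.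
Let d_small (e : R) : 0 < e -> exists n, d n < e.
Proof.
move=> e0; exists (Num.trunc e^-1).
rewrite invf_plt ?posrE ?ltr0n//; apply: truncnS_gt.
Qed.

(** The ramps rise on intervals that shrink to [c] from the right, each one to the
    left of the previous one. *)
Lemma right_small x c (e : R) : 0 < e -> exists2 delta : R, 0 < delta &
  forall h, AC h -> flat_near h 0 c -> (forall t, lts t c -> h t = 0) ->
    (forall t, set_val c + delta <= set_val t -> h t = 0) ->
    N (Phi h x) <= e * rBV h.
Proof.
move=> e0; pose k n : sigma -> R[i] :=
  realf (ramp (set_val c + d n.+1) (set_val c + d n)).
have uv n : set_val c + d n.+1 < set_val c + d n by rewrite ltrD2l d_lt.
have k0 n t : set_val t <= set_val c + d n.+1 -> k n t = 0.
  by move=> tc; rewrite /k /realf ramp_le.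
have k1 n t : set_val c + d n <= set_val t -> k n t = 1.
  by move=> tc; rewrite /k /realf ramp_ge.
have [n|n|m n nm|n kn] := @monotone_sequence_small k 2 x e _ _ _ e0.
- exact: (ACr_ramp sigma0 sigma_le _ _).
- exact: rBV_ramp.
- apply/funext => t; rewrite fctE.
  have [/k0 ->|ct] := leP (set_val t) (set_val c + d n.+1); first by rewrite mulr0.
  by rewrite k1 ?mul1r// (le_trans _ (ltW ct))// lerD2l d_le.
exists (d n.+1); first exact: d_gt0.
move=> h ah [eta eta0 heta] hl hr; apply: kn => //.
  apply/funext => t; rewrite fctE.
  by have [/k0 ->|/ltW/hr ->] := leP (set_val t) (set_val c + d n.+1); rewrite ?mulr0 ?mul0r.
have [m md] := d_small eta0; exists m; apply/funext => t; rewrite fctE.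
have [tc|tc] := ltP (set_val t) (set_val c); first by rewrite hl// mul0r.
have [te|te] := ltP (set_val t - set_val c) eta.
  by rewrite heta ?mul0r// ger0_norm ?subr_ge0.
by rewrite k1 ?mulr1// -lerBrDl (le_trans (ltW md)).
Qed.

Lemma left_small x c (e : R) : 0 < e -> exists2 delta : R, 0 < delta &
  forall h, AC h -> flat_near h 0 c -> (forall t, set_val c <= set_val t -> h t = 0) ->
    (forall t, set_val t <= set_val c - delta -> h t = 0) ->
    N (Phi h x) <= e * rBV h.
Proof.
move=> e0; pose r n : sigma -> R[i] :=
  realf (ramp (set_val c - d n) (set_val c - d n.+1)).
pose k n := cst 1 - r n.
have uv n : set_val c - d n < set_val c - d n.+1 by rewrite ltrD2l ltrN2 d_lt.
have k1 n t : set_val t <= set_val c - d n -> k n t = 1.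
  by move=> tc; rewrite /k /r /realf !fctE ramp_le// subr0.
have k0 n t : set_val c - d n.+1 <= set_val t -> k n t = 0.
  by move=> tc; rewrite /k /r /realf !fctE ramp_ge// subrr.
have a1 := AC_cst sigma0 sigma_le 1.
have ar n : AC (r n) := ACr_ramp sigma0 sigma_le _ _.
have [n|n|m n nm|n kn] := @monotone_sequence_small k 3 x e _ _ _ e0.
- exact: acS.
- apply: le_trans (BV_sub sigma0 (AC_BV a1) (AC_BV (ar n))).2 _.
  by have := rBV_ramp sigma0 (uv n); have := (BV_cst sigma0 1).2; rewrite normc1; lra.
- apply/funext => t; rewrite fctE.
  have [/k0 ->|ct] := leP (set_val c - d n.+1) (set_val t); first by rewrite mulr0.
  by rewrite k1 ?mul1r// (le_trans (ltW ct))// lerD2l lerN2 d_le.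
exists (d n.+1); first exact: d_gt0.
move=> h ah [eta eta0 heta] hr hl; apply: kn => //.
  apply/funext => t; rewrite fctE.
  by have [/k0 ->|/ltW/hl ->] := leP (set_val c - d n.+1) (set_val t); rewrite ?mulr0 ?mul0r.
have [m md] := d_small eta0; exists m; apply/funext => t; rewrite fctE.
have [tc|tc] := leP (set_val c) (set_val t); first by rewrite hr// mul0r.
have [te|te] := ltP (set_val c - set_val t) eta.
  by rewrite heta ?mul0r// distrC ger0_norm// subr_ge0 ltW.
by rewrite k1 ?mulr1//; lra.
Qed.

Let rBV_le_rvar h c : BV h -> h c = 0 -> rBV h <= 2 * rvar h.
Proof.
move=> bh hc; rewrite /rBV.
suff : rsup h <= rvar h by lra.
apply: rsup_le => // t.
by have := dist_le_rvar sigma0 c t bh; rewrite hc subr0.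
Qed.

(** The central estimate for the functions that live to the left of [a]; it will be
    propagated by increasing [a]. *)
Definition controlled_below x (e a : R) : Prop := exists P, forall h, AC h ->
  (forall p, p \in P -> flat_near h 0 p) ->
  (forall t, a <= set_val t -> h t = 0) -> N (Phi h x) <= e * rvar h.

Let flat_cut_ge h c p : flat_near h 0 p ->
  flat_near (fun t => if lts t c then 0 else h t) 0 p.
Proof. by move=> [eta eta0 heta]; exists eta => // t /heta ->; case: ifP. Qed.

Let flat_cut_lt h c p : flat_near h 0 p ->
  flat_near (fun t => if lts t c then h t else 0) 0 p.
Proof. by move=> [eta eta0 heta]; exists eta => // t /heta ->; case: ifP. Qed.

Let N_cut x (e : R) h c : 0 < e -> AC h -> flat_near h 0 c ->
  N (Phi (fun t => if lts t c then h t else 0) x) <=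
    e * rvar (fun t => if lts t c then h t else 0) ->
  N (Phi (fun t => if lts t c then 0 else h t) x) <=
    e * rvar (fun t => if lts t c then 0 else h t) ->
  N (Phi h x) <= e * rvar h.
Proof.
move=> e0 ah hc l1 l2.
have al := AC_cut_lt sigma0 sigma_le ah hc; have ar := AC_cut_ge sigma0 sigma_le ah hc.
have -> : Phi h x = 1 *: Phi (fun t => if lts t c then h t else 0) x +
    Phi (fun t => if lts t c then 0 else h t) x.
  rewrite -Phi_lin// scale1r; congr (Phi _ x).
  by apply/funext => t; rewrite fctE; case: ifP; rewrite ?addr0 ?add0r.
rewrite scale1r; apply: le_trans (N_add _ _) _; apply: le_trans (lerD l1 l2) _.
rewrite -mulrDr; apply: ler_wpM2l; first exact: ltW.
exact: (rvar_cut sigma0 (AC_BV ah) (flat_near_at hc)).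
Qed.

(** A point [c'] of [sigma] close to [c] on its left separates what is known from
    what [left_small] controls.  If there is no such point, there is nothing
    left to control. *)
Lemma controlled_left x (e : R) c : 0 < e ->
  (forall a, a < set_val c -> controlled_below x e a) ->
  controlled_below x e (set_val c).
Proof.
move=> e0 ctrl.
have [delta delta0 small] := left_small x c (e := e / 2) ltac:(lra).
have [[c' [c'd c'c]]|noc] := pselect (exists c' : sigma,
    set_val c - delta < set_val c' /\ set_val c' < set_val c).
  have [P hP] := ctrl _ c'c; exists [:: c, c' & P] => h ah hflat hz.
  have hc : flat_near h 0 c by apply: hflat; rewrite inE eqxx.
  have hc' : flat_near h 0 c' by apply: hflat; rewrite !inE eqxx orbT.
  apply: (N_cut e0 ah hc').
    apply: hP; first exact: (AC_cut_lt sigma0 sigma_le ah hc').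
      by move=> p pP; apply/flat_cut_lt/hflat; rewrite !inE pP !orbT.
    by move=> t ct; rewrite /lts ltNge ct.
  have a2 := AC_cut_ge sigma0 sigma_le ah hc'.
  apply: le_trans (small _ a2 _ _ _) _.
  - exact: flat_cut_ge.
  - by move=> t ct; rewrite hz//; case: ifP.
  - by move=> t ct; rewrite /lts (le_lt_trans ct c'd).
  have := rBV_le_rvar (c := c') (AC_BV a2); rewrite {1}(flat_near_at hc').
  have e20 : 0 <= e / 2 by lra.
  by rewrite if_same => /(_ erefl)/(ler_wpM2l e20); lra.
have [P hP] := ctrl (set_val c - delta / 2) ltac:(lra).
exists (c :: P) => h ah hflat hz; apply: hP => // [p pP|t ct].
  by apply: hflat; rewrite inE pP orbT.
have [tc|tc] := leP (set_val c) (set_val t); first exact: hz.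
by exfalso; apply: noc; exists t; split=> //; lra.
Qed.

Lemma controlled_right x (e : R) c : 0 < e ->
  controlled_below x e (set_val c) ->
  exists2 delta, 0 < delta & controlled_below x e (set_val c + delta).
Proof.
move=> e0 [P hP].
have [delta delta0 small] := right_small x c (e := e / 2) ltac:(lra).
exists delta => //; exists (c :: P) => h ah hflat hz.
have hc : flat_near h 0 c by apply: hflat; rewrite inE eqxx.
apply: (N_cut e0 ah hc).
  apply: hP; first exact: (AC_cut_lt sigma0 sigma_le ah hc).
    by move=> p pP; apply/flat_cut_lt/hflat; rewrite !inE pP !orbT.
  by move=> t ct; rewrite /lts ltNge ct.
have a2 := AC_cut_ge sigma0 sigma_le ah hc.
apply: le_trans (small _ a2 _ _ _) _.
- exact: flat_cut_ge.
- by move=> t ->.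
- by move=> t ct; rewrite hz//; case: ifP.
have := rBV_le_rvar (c := c) (AC_BV a2); rewrite {1}(flat_near_at hc).
have e20 : 0 <= e / 2 by lra.
by rewrite if_same => /(_ erefl)/(ler_wpM2l e20); lra.
Qed.

Lemma controlled_gap x (e a : R) : ~ sigma a ->
  (forall b, b < a -> controlled_below x e b) ->
  exists2 delta, 0 < delta & controlled_below x e (a + delta).
Proof.
move=> na ctrl.
have /nbhs_ballP[/= delta delta0 gap] : nbhs a (~` sigma).
  by apply: open_nbhs_nbhs; split=> //; exact: closed_openC.
have [P hP] := ctrl (a - delta / 2) ltac:(lra).
exists (delta / 2); first by lra.
exists P => h ah hflat hz; apply: hP => // t ta.
have [tb|tb] := leP (a + delta / 2) (set_val t); first exact: hz.
exfalso; apply: (gap (set_val t)); last exact: set_valP.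
by rewrite /ball/= distrC ltr_norml; apply/andP; split; lra.
Qed.

(** The numbers [a] below which the estimate holds form an initial segment; it
    cannot have a supremum, at which it could be continued by [controlled_right]
    or [controlled_gap]. *)
Lemma flat_near_small x (e : R) : 0 < e -> exists P, forall h, AC h ->
  (forall p, p \in P -> flat_near h 0 p) -> N (Phi h x) <= e * rvar h.
Proof.
move=> e0; pose S := [set a | controlled_below x e a].
have down a b : a <= b -> S b -> S a.
  move=> ab [P hP]; exists P => h ah hf hz; apply: hP => // t bt.
  by apply: hz; exact: le_trans bt.
have S0 : S (- M).
  exists [::] => h ah _ hz; have -> : h = 0.
    apply/funext => t; apply: hz.
    by have := sigma_le t; rewrite ler_norml => /andP[].
  by rewrite Phi_0 N0 mulr_ge0 ?(ltW e0) ?rvar_ge0.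
suff : S (M + 1).
  move=> [P hP]; exists P => h ah hf; apply: hP => // t.
  by have := sigma_le t; rewrite ler_norml => /andP[_ ? ?]; exfalso; lra.
apply: contrapT => nS.
have Ssup : has_sup S.
  split; first by exists (- M).
  exists (M + 1) => a Sa; rewrite leNgt; apply/negP => /ltW aM.
  by apply: nS; exact: (down _ _ aM Sa).
have ctrl b : b < sup S -> controlled_below x e b.
  by move=> /(sup_gt Ssup.1)[a Sa ba]; exact: (down _ _ (ltW ba) Sa).
have [delta delta0 Sd] : exists2 delta, 0 < delta & S (sup S + delta).
  have [ss|ns] := pselect (sigma (sup S)); last exact: controlled_gap.
  pose c : sigma := exist _ (sup S) (mem_set ss).
  exact: (controlled_right (c := c) e0 (controlled_left (c := c) e0 ctrl)).
have := ub_le_sup Ssup.2 Sd; lra.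
Qed.

Definition flat_on f P g : Prop := forall p, p \in P -> flat_near g (f p) p.

(** [y] is the limit of [Phi g x] over the approximants [g] of [f] of norm at most
    [b].  Requiring this for all [b] makes sums and products of
    approximants admissible for sums and products of functions. *)
Definition calculus_value f x y : Prop := forall (b e : R), 0 < e ->
  exists P, forall g, AC g -> flat_on f P g -> rBV g <= b ->
    N (Phi g x - y) <= e.

Lemma calculus_value_unique f x y z (b : R) : calculus_value f x y ->
  (forall P (e : R), 0 < e -> exists g,
    [/\ AC g, flat_on f P g, rBV g <= b & N (Phi g x - z) <= e]) -> y = z.
Proof.
move=> fy fz; apply/eqP; rewrite -subr_eq0; apply/eqP/N_small => e e0.
have [P hP] := fy b (e / 2) ltac:(lra).
have [g [ag gP gb gz]] := fz P (e / 2) ltac:(lra).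
have := hP g ag gP gb; have := N_dist y (Phi g x) z.
rewrite (N_distC y (Phi g x)); lra.
Qed.

Let flat_on_sub f P g g' : flat_on f P g -> flat_on f P g' ->
  forall p, p \in P -> flat_near (g - g') 0 p.
Proof.
move=> gP g'P p pP; rewrite -(subrr (f p)).
by apply: flat_near_sub; [exact: gP|exact: g'P].
Qed.

(** The approximants [g n] on larger and larger finite sets give an [N]-Cauchy
    sequence by [flat_near_small].  Its limit comes from the Mazur property, as the
    hull of a tail has no larger diameter than the tail. *)
Lemma calculus_value_exists f x : BV f ->
  exists2 y, calculus_value f x y & B y <= K * (2 * rBV f) * `|B x|.
Proof.
move=> bf; pose b := 2 * rBV f.
have b0 : 0 <= b by rewrite mulr_ge0// rBV_ge0.
have /choice[P hP] : forall n, exists P, forall h, AC h ->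
    (forall p, p \in P -> flat_near h 0 p) -> N (Phi h x) <= d n * rvar h.
  by move=> n; exact: flat_near_small.
pose Q n := flatten [seq P i | i <- iota 0 n.+1].
have PQ n m p : (n <= m)%N -> p \in P n -> p \in Q m.
  move=> nm pn; apply/flattenP; exists (P n) => //.
  by apply/mapP; exists n => //; rewrite mem_iota.
have /choice[g hg] : forall n, exists g,
    [/\ AC g, flat_on f (Q n) g & rBV g <= b].
  by move=> n; exact: (AC_interpolation sigma0 sigma_le).
have close n (g1 g2 : sigma -> R[i]) (b1 b2 : R) : AC g1 -> AC g2 ->
    flat_on f (P n) g1 -> flat_on f (P n) g2 -> rBV g1 <= b1 -> rBV g2 <= b2 ->
    N (Phi g1 x - Phi g2 x) <= d n * (b1 + b2).
  move=> a1 a2 f1 f2 r1 r2; rewrite -Phi_sub//.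
  apply: le_trans (hP n _ (acS a1 a2) (flat_on_sub f1 f2)) _.
  apply: ler_wpM2l; first exact: ltW.
  apply: le_trans (rvar_le_rBV sigma0 _) _.
  by apply: le_trans (BV_sub sigma0 (AC_BV a1) (AC_BV a2)).2 _; exact: lerD.
have gflat n m : (n <= m)%N -> flat_on f (P n) (g m).
  by move=> nm p pn; have [_ gm _] := hg m; apply: gm; exact: PQ pn.
have [n|y By ylim] := @mazur (K * b * `|B x|) (fun n => Phi (g n) x).
  have [ag _ gb] := hg n; apply: (le_trans (Phi_B ag x)).
  apply: (@le_trans _ _ (K * rBV (g n) * `|B x|)).
    by rewrite ler_wpM2l ?ler_norm// mulr_ge0// rBV_ge0.
  by rewrite ler_wpM2r// ler_wpM2l.
have gy n : N (Phi (g n) x - y) <= d n * (b + b).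
  apply/ler_addgt0Pr => e e0; have [y' hy' y'y] := ylim n e e0.
  have : N (y' - Phi (g n) x) <= d n * (b + b).
    apply: (hy' [set z | N (z - Phi (g n) x) <= d n * (b + b)]).
      move=> u v /= hu hv; rewrite -{1}(midpoint_id (Phi (g n) x)) -scalerBr.
      by rewrite opprD addrACA; apply: le_trans (N_mid _ _) _; lra.
    move=> m nm /=; have [am _ bm] := hg m; have [an _ bn] := hg n.
    by apply: close => //; exact: gflat.
  by have := N_dist (Phi (g n) x) y' y; rewrite (N_distC _ y'); lra.
exists y => // b' e e0.
pose c := `|b'| + b + (b + b) + 1.
have c0 : 0 < c by rewrite /c; have := normr_ge0 b'; lra.
have [n dn] := d_small (divr_gt0 e0 c0).
exists (P n) => h ah hf hb.
have [an _ bn] := hg n.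
have h1 := close n h (g n) _ _ ah an hf (gflat n n (leqnn n)) hb bn.
apply: le_trans (N_dist _ (Phi (g n) x) _) _; apply: le_trans (lerD h1 (gy n)) _.
move: dn; rewrite ltr_pdivlMr// => /ltW; apply: le_trans.
rewrite -mulrDr; apply: ler_wpM2l; first exact: ltW.
by rewrite /c; have := ler_norm b'; lra.
Qed.

Let Psi f x : X := if pselect (BV f) is left bf then
  projT1 (cid2 (calculus_value_exists x bf)) else 0.

Let PsiP f x : BV f -> calculus_value f x (Psi f x).
Proof. by move=> bf; rewrite /Psi; case: pselect => // bf'; case: cid2. Qed.

Let Psi_B f x : BV f -> B (Psi f x) <= K * (2 * rBV f) * `|B x|.
Proof. by move=> bf; rewrite /Psi; case: pselect => // bf'; case: cid2. Qed.

Let Psi_approx f x : BV f -> forall P (e : R), 0 < e -> exists g,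
  [/\ AC g, flat_on f P g, rBV g <= 2 * rBV f & N (Phi g x - Psi f x) <= e].
Proof.
move=> bf P e e0; have [Q hQ] := PsiP x bf (2 * rBV f) e0.
have [g [ag gP gb]] := AC_interpolation sigma0 sigma_le (P ++ Q) bf.
exists g; split=> //; first by move=> p pP; apply: gP; rewrite mem_cat pP.
by apply: hQ => // p pQ; apply: gP; rewrite mem_cat pQ orbT.
Qed.

Let Psi_approx2 f x y : BV f -> forall P (e : R), 0 < e -> exists g,
  [/\ AC g, flat_on f P g, rBV g <= 2 * rBV f, N (Phi g x - Psi f x) <= e &
    N (Phi g y - Psi f y) <= e].
Proof.
move=> bf P e e0; have [Q hQ] := PsiP y bf (2 * rBV f) e0.
have [g [ag gP gb gx]] := Psi_approx x bf (P ++ Q) e0.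
exists g; split=> //; first by move=> p pP; apply: gP; rewrite mem_cat pP.
by apply: hQ => // p pQ; apply: gP; rewrite mem_cat pQ orbT.
Qed.

Let Psi_linear f (a : R[i]) x y : BV f ->
  Psi f (a *: x + y) = a *: Psi f x + Psi f y.
Proof.
move=> bf; apply: (calculus_value_unique (b := 2 * rBV f) (PsiP _ bf)) => P e e0.
have a0 : 0 < normc a + 1 by rewrite ltr_wpDl// normc_ge0.
have [g [ag gP gb gx gy]] := Psi_approx2 x y bf P (divr_gt0 e0 a0).
exists g; split=> //.
rewrite linearD linearZ/= opprD addrACA -scalerBr.
apply: le_trans (N_add _ _) _; rewrite N_scale.
move: gx gy; rewrite !ler_pdivlMr// => gx gy.
have := normc_ge0 a; nra.
Qed.

Let Psi_lin f g (a : R[i]) x : BV f -> BV g ->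
  Psi (a *: f + g) x = a *: Psi f x + Psi g x.
Proof.
move=> bf bg; apply: (calculus_value_unique
  (PsiP _ (BV_lin sigma0 a bf bg).1)) => P e e0.
have a0 : 0 < normc a + 1 by rewrite ltr_wpDl// normc_ge0.
have [f' [af fP fb fx]] := Psi_approx x bf P (divr_gt0 e0 a0).
have [g' [ag gP gb gx]] := Psi_approx x bg P (divr_gt0 e0 a0).
exists (a *: f' + g'); split.
- exact: (AC_lin sigma0 sigma_le).
- by move=> p pP; apply: flat_near_lin; [exact: fP|exact: gP].
- apply: le_trans (BV_lin sigma0 a (AC_BV af) (AC_BV ag)).2 _.
  exact: lerD (ler_wpM2l (normc_ge0 a) fb) gb.
rewrite Phi_lin// opprD addrACA -scalerBr.
apply: le_trans (N_add _ _) _; rewrite N_scale.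
move: fx gx; rewrite !ler_pdivlMr// => fx gx.
have := normc_ge0 a; nra.
Qed.

Let Psi_mul f g x : BV f -> BV g -> Psi (f * g) x = Psi f (Psi g x).
Proof.
move=> bf bg; apply: (calculus_value_unique
  (PsiP _ (BV_mul sigma0 bf bg).1)) => P e e0.
pose c := K * (2 * rBV f) + 1.
have c1 : 1 <= c by rewrite lerDr !mulr_ge0// rBV_ge0.
have c0 : 0 < c by lra.
have [f' [af fP fb fx]] := Psi_approx (Psi g x) bf P (divr_gt0 e0 (ltr0n R 2)).
have [g' [ag gP gb gx]] := Psi_approx x bg P (divr_gt0 (divr_gt0 e0 (ltr0n R 2)) c0).
exists (f' * g'); split.
- exact: acM.
- by move=> p pP; apply: flat_near_mul; [exact: fP|exact: gP].
- apply: le_trans (BV_mul sigma0 (AC_BV af) (AC_BV ag)).2 _.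
  exact: ler_pM (rBV_ge0 sigma0 _) (rBV_ge0 sigma0 _) fb gb.
rewrite Phi_mul//; apply: le_trans (N_dist _ (Phi f' (Psi g x)) _) _.
rewrite -linearB; have := Phi_N af (Phi g' x - Psi g x).
move: gx; rewrite ler_pdivlMr//.
have : K * rBV f' * N (Phi g' x - Psi g x) <= c * N (Phi g' x - Psi g x).
  apply: ler_wpM2r => //; rewrite /c ler_wpDr//.
  exact: ler_wpM2l.
lra.
Qed.

Let Psi_N f x : BV f -> N (Psi f x) <= K * (2 * rBV f) * N x.
Proof.
move=> bf; apply/ler_addgt0Pr => e e0.
have [g [ag _ gb gx]] := Psi_approx x bf [::] e0.
have := N_add (Phi g x) (Psi f x - Phi g x); rewrite addrC subrK N_distC.
have := Phi_N ag x.
have : K * rBV g * N x <= K * (2 * rBV f) * N x.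
  by apply: ler_wpM2r => //; exact: ler_wpM2l.
lra.
Qed.

(** The function [t |-> t] is not itself an approximant, not being locally constant;
    but its flattenings are, and they are close to it in the norm of BV. *)
Let Psi_id x : Psi (realf id) x = Phi (realf id) x.
Proof.
have ai : AC (realf id : sigma -> R[i]) := ACr_id sigma0 sigma_le.
have bi := AC_BV ai.
apply: (calculus_value_unique (b := rBV (realf id : sigma -> R[i]) + 1) (PsiP _ bi)).
move=> P e e0; pose c := K * N x + 1.
have c1 : 1 <= c by rewrite lerDr mulr_ge0.
have c0 : 0 < c by lra.
have [|g [ag gP _ ge]] := id_flattening sigma0 sigma_le P (e := Num.min 1 (e / c)).
  by rewrite lt_min ltr01 divr_gt0.
move: ge; rewrite le_min => /andP[g1 ge].
have aig := acS ai ag; exists g; split=> //.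
  have := (BV_sub sigma0 bi (AC_BV aig)).2; rewrite opprB addrC subrK; lra.
rewrite N_distC -Phi_sub//; apply: le_trans (Phi_N aig x) _.
move: ge; rewrite ler_pdivlMr//.
rewrite mulrDr mulr1 mulrCA !mulrA.
have := rBV_ge0 sigma0 (realf id - g); lra.
Qed.

Let Psi_cst (a : R[i]) x : Psi (cst a) x = Phi (cst a) x.
Proof.
have aa : AC (cst a : sigma -> R[i]) := AC_cst sigma0 sigma_le a.
apply: (calculus_value_unique (b := rBV (cst a : sigma -> R[i])) (PsiP _ (AC_BV aa))).
move=> P e e0; exists (cst a); split=> //; last by rewrite subrr N0 ltW.
by move=> p _; exists 1.
Qed.

Let Psi_poly (p : {poly R[i]}) x : Psi (poly_on p) x = Phi (poly_on p) x.
Proof.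
elim/poly_ind: p x => [|p a IH] x; first by rewrite poly_onC Psi_cst.
have ai : AC (realf id : sigma -> R[i]) := ACr_id sigma0 sigma_le.
have ap : AC (poly_on p : sigma -> R[i]) := AC_poly sigma0 sigma_le p.
have aa : AC (cst a : sigma -> R[i]) := AC_cst sigma0 sigma_le a.
have api := acM ap ai.
rewrite -[p * 'X]scale1r poly_on_lin poly_onM poly_onC poly_onX.
rewrite Phi_lin// Psi_lin; [|exact: AC_BV..].
rewrite Psi_cst Phi_mul// Psi_mul; [|exact: AC_BV..].
by rewrite Psi_id IH.
Qed.

Let Psi_AC f x : AC f -> Psi f x = Phi f x.
Proof.
move=> af; apply/eqP; rewrite -subr_eq0; apply/eqP/N_small => e e0.
pose c := K * 3 * N x + 1.
have c1 : 1 <= c by rewrite lerDr !mulr_ge0.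
have c0 : 0 < c by lra.
have [p bfp pe] := AC_approx sigma0 af (divr_gt0 e0 c0).
have ap : AC (poly_on p : sigma -> R[i]) := AC_poly sigma0 sigma_le p.
have afp := acS af ap.
have fE : f = 1 *: (f - poly_on p) + poly_on p by rewrite scale1r subrK.
rewrite {1 2}fE Psi_lin ?Phi_lin//; [|exact: AC_BV..].
rewrite Psi_poly opprD addrACA subrr addr0 !scale1r.
apply: le_trans (N_add _ _) _; rewrite N_opp.
have := Psi_N x bfp; have := Phi_N afp x.
move: pe; rewrite ltr_pdivlMr// /c mulrDr mulr1.
have := rBV_ge0 sigma0 (f - poly_on p); nra.
Qed.

Theorem BV_extension : exists Psi : (sigma -> R[i]) -> X -> X, [/\
  forall f (a : R[i]) x y, Psi f (a *: x + y) = a *: Psi f x + Psi f y,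
  forall f g (a : R[i]) x, BV f -> BV g ->
    Psi (a *: f + g) x = a *: Psi f x + Psi g x,
  forall f g x, BV f -> BV g -> Psi (f * g) x = Psi f (Psi g x),
  forall f x, BV f -> B (Psi f x) <= K * (2 * rBV f) * `|B x| &
  forall f x, AC f -> Psi f x = Phi f x].
Proof.
exists Psi; split=> [f a x y|f g a x|f g x|f x|f x]; [|exact: Psi_lin|
  exact: Psi_mul|exact: Psi_B|exact: Psi_AC].
have [bf|nbf] := pselect (BV f); first exact: Psi_linear.
by rewrite /Psi; case: pselect => // _; rewrite scaler0 addr0.
Qed.

End extension.

(** * Square integrals of bounded functions *)
Section parallelogram_minimisation.
Variables (R : realType) (X : lmodType R[i]) (q : X -> R).
Hypothesis q_ge0 : forall x, 0 <= q x.
Hypothesis q_par : forall x y, q (x - y) = 2 * q x + 2 * q y - 4 * q (2^-1 *: (x + y)).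

Lemma tail_hull_mono (x : nat -> X) m n : (n <= m)%N ->
  tail_hull x m `<=` tail_hull x n.
Proof.
by move=> nm y hy C Cm Cx; apply: (hy C Cm) => k mk; apply: Cx; exact: leq_trans mk.
Qed.

Lemma tail_hull_midpoint (x : nat -> X) n : midpoint_closed (tail_hull x n).
Proof. by move=> u v hu hv C Cm Cx; apply: (Cm); [exact: hu|exact: hv]. Qed.

Lemma tail_hull_self (x : nat -> X) n : tail_hull x n (x n).
Proof. by move=> C _; apply; exact: leqnn. Qed.

(** The infima of [q] over the hulls increase to a finite limit [D].  If [y m] and
    [y n] are near-minimisers, their midpoint still lies in a hull on which [q] is
    almost at least [D], so the parallelogram law leaves little room for
    [q (y m - y n)]. *)
Lemma tail_hull_cauchy (x : nat -> X) (b : R) (eps : nat -> R) :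
  (forall y, tail_hull x 0%N y -> q y <= b) ->
  (forall n, 0 < eps n) -> {homo eps : m n / (m <= n)%N >-> n <= m} ->
  exists y : nat -> X, (forall n, tail_hull x n (y n)) /\
    forall m n, (m <= n)%N -> q (y m - y n) <= 8 * eps m.
Proof.
move=> qb e0 emono.
pose H n := q @` tail_hull x n.
have xH n : H n (q (x n)) by exists (x n) => //; exact: tail_hull_self.
have H_inf n : has_inf (H n).
  split; first by exists (q (x n)); exact: xH.
  by exists 0 => _ [y _ <-]; exact: q_ge0.
pose dn n := inf (H n).
have dn_le n y : tail_hull x n y -> dn n <= q y.
  by move=> hy; apply: (ge_inf (H_inf n).2); exists y.
pose D := [set dn n | n in [set: nat]].
have D_sup : has_sup D.
  split; first by exists (dn 0%N), 0%N.
  exists b => _ [n _ <-]; apply: (le_trans (dn_le n (x n) _)).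
    exact: tail_hull_self.
  by apply: qb; apply: (tail_hull_mono (leq0n n)); exact: tail_hull_self.
have dn_sup n : dn n <= sup D by apply: (ub_le_sup D_sup.2); exists n.
have dn_mono m n : (n <= m)%N -> dn n <= dn m.
  move=> nm; apply: lb_le_inf; first exact: (H_inf m).1.
  by move=> _ [y hy <-]; apply: dn_le; exact: (tail_hull_mono _ hy).
have pick k : exists z : nat * X, [/\ (k <= z.1)%N, sup D - eps k < dn z.1,
    tail_hull x z.1 z.2 & q z.2 < sup D + eps k].
  have [_ [n _ <-] nD] := sup_adherent (e0 k) D_sup.
  have [_ [y hy <-] yd] := inf_adherent (e0 k) (H_inf (maxn k n)).
  exists (maxn k n, y); split=> //=; first exact: leq_maxl.
    by apply: (lt_le_trans nD); apply: dn_mono; exact: leq_maxr.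
  by apply: (lt_le_trans yd); rewrite lerD2r; exact: dn_sup.
have /choice[z hz] := pick.
exists (fun k => (z k).2); split=> [n|m n mn].
  by have [zn _ hy _] := hz n; exact: (tail_hull_mono _ hy).
have [_ dm hm qm] := hz m; have [_ dk hk qk] := hz n.
have emn := emono _ _ mn.
pose k := minn (z m).1 (z n).1.
have mid : tail_hull x k (2^-1 *: ((z m).2 + (z n).2)).
  apply: tail_hull_midpoint; first exact: (tail_hull_mono (geq_minl _ _) hm).
  exact: (tail_hull_mono (geq_minr _ _) hk).
have : sup D - eps m < dn k.
  by rewrite /k; case: leqP => _ //; lra.
have := dn_le _ _ mid; rewrite q_par; lra.
Qed.

End parallelogram_minimisation.

Section square_integral.
Context d (T : measurableType d) (R : realType).
Variable mu : {finite_measure set T -> \bar R}.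
Implicit Types (f g : L0 mu).

Lemma measurable_normc_L0 f : measurable_fun [set: T] (fun t => normc (f t)).
Proof. exact/measurable_normc/measurable_L0. Qed.

Lemma L0_subE f g : (f - g : L0 mu) = (fun t => f t - g t) %[ae mu].
Proof.
have := L0_addE f (- g); have := L0_scaleE (- 1) g; rewrite scaleN1r.
by apply: filterS2 => t h1 h2 tT; rewrite h2// h1// mulN1r.
Qed.

Lemma measurable_sub_complex (h k : T -> R[i]) : measurable_fun [set: T] h ->
  measurable_fun [set: T] k -> measurable_fun [set: T] (fun t => h t - k t).
Proof.
move=> mh mk; rewrite (_ : (fun _ => _) = (fun t => h t + -1 * k t)).
  apply: measurable_add_complex => //.
  exact: (measurable_mul_complex (@measurable_cst _ _ _ _ _ _) mk).
by apply/funext => t; rewrite mulN1r.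
Qed.

Lemma sqr_normc_ReIm (z : R[i]) :
  normc z ^+ 2 = complex.Re z ^+ 2 + complex.Im z ^+ 2.
Proof. by case: z => a b; rewrite /normc sqr_sqrtr// addr_ge0// sqr_ge0. Qed.

Lemma normc_parallelogram (z w : R[i]) :
  normc (z + w) ^+ 2 + normc (z - w) ^+ 2 = 2 * normc z ^+ 2 + 2 * normc w ^+ 2.
Proof. by rewrite !sqr_normc_ReIm; case: z w => [a b] [c e] /=; ring. Qed.

Definition sqint f : \bar R := (\int[mu]_t (normc (f t) ^+ 2)%:E)%E.

Lemma sqint_ae f (h : T -> R[i]) : measurable_fun [set: T] h ->
  (f : T -> R[i]) = h %[ae mu] ->
  sqint f = (\int[mu]_t (normc (h t) ^+ 2)%:E)%E.
Proof.
move=> mh fh; apply: ae_eq_integral => //.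
- apply/measurable_EFinP; apply: measurable_funX; exact: measurable_normc_L0.
- by apply/measurable_EFinP; apply: measurable_funX; exact: measurable_normc.
- by apply: filterS fh => t ft tT; rewrite ft.
Qed.

Lemma sqint_parallelogram f g :
  (sqint (f + g)%R + sqint (f - g)%R = 2%:E * sqint f + 2%:E * sqint g)%E.
Proof.
have mf := measurable_L0 f; have mg := measurable_L0 g.
have msq (h : T -> R[i]) : measurable_fun [set: T] h ->
    measurable_fun [set: T] (fun t => (normc (h t) ^+ 2)%:E).
  by move=> mh; apply/measurable_EFinP; apply: measurable_funX; exact: measurable_normc.
have mp := measurable_add_complex mf mg; have mm := measurable_sub_complex mf mg.
rewrite (sqint_ae mp (L0_addE f g)) (sqint_ae mm (L0_subE f g)) /sqint.
rewrite -ge0_integralD//; [|by move=> t _; rewrite lee_fin sqr_ge0|exact: (msq _ mp)|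
  by move=> t _; rewrite lee_fin sqr_ge0|exact: (msq _ mm)].
rewrite -!ge0_integralZl//; [|exact: msq|by move=> t _; rewrite lee_fin sqr_ge0|
  exact: msq|by move=> t _; rewrite lee_fin sqr_ge0].
rewrite -ge0_integralD//; last 4 first.
- by move=> t _; rewrite -EFinM lee_fin mulr_ge0// sqr_ge0.
- by apply: measurable_funeM; exact: msq.
- by move=> t _; rewrite -EFinM lee_fin mulr_ge0// sqr_ge0.
- by apply: measurable_funeM; exact: msq.
by apply: eq_integral => t _; rewrite -!EFinM -!EFinD normc_parallelogram.
Qed.

Lemma sqint_scale (a : R[i]) f : sqint (a *: f) = ((normc a ^+ 2)%:E * sqint f)%E.
Proof.
have mf := measurable_L0 f.
have ma := measurable_mul_complex (@measurable_cst _ _ T R[i] setT a) mf.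
rewrite (sqint_ae ma (L0_scaleE a f)) /sqint -ge0_integralZl//.
- by apply: eq_integral => t _; rewrite normcM exprMn EFinM.
- by apply/measurable_EFinP; apply: measurable_funX; exact: measurable_normc.
- by move=> t _; rewrite lee_fin sqr_ge0.
- by rewrite lee_fin sqr_ge0.
Qed.

Lemma sqint_le f (b : R) : {ae mu, forall t, normc (f t) <= b} ->
  (sqint f <= (b ^+ 2)%:E * mu [set: T])%E.
Proof.
move=> fb; rewrite -integral_cst//; apply: ae_ge0_le_integral => //.
- by move=> t _; rewrite lee_fin sqr_ge0.
- apply/measurable_EFinP; apply: measurable_funX; exact: measurable_normc_L0.
- by move=> t _; rewrite lee_fin sqr_ge0.
- apply: filterS fb => t tb _; rewrite lee_fin lerXn2r ?nnegrE ?normc_ge0//.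
  by apply: le_trans tb; exact: normc_ge0.
Qed.

Lemma Linf_normc_le f (b : R) : (Lpnorm +oo f <= b%:E)%E ->
  {ae mu, forall t, normc (f t) <= b}.
Proof.
rewrite /Lpnorm unlock; case: ifPn => [muT|muT _].
  by move=> /ess_supP; apply: filterS => t /=; rewrite lee_fin ger0_norm ?normc_ge0.
exists [set: T]; split=> //.
by apply/eqP; rewrite eq_le measure_ge0 andbT leNgt.
Qed.

Lemma normc_le_Linf f (b : R) : 0 <= b -> {ae mu, forall t, normc (f t) <= b} ->
  (Lpnorm +oo f <= b%:E)%E.
Proof.
move=> b0 fb; rewrite /Lpnorm unlock; case: ifPn => muT; last by rewrite lee_fin.
apply/ess_supP; apply: filterS fb => t /=; by rewrite lee_fin ger0_norm ?normc_ge0.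
Qed.

(** This is where the finiteness of the measure makes L^oo a subspace of L^r. *)
Lemma Lpnorm_le_bound (r : R) (r1 : (1 <= r%:E)%E) f (b : R) : 0 <= b ->
  {ae mu, forall t, normc (f t) <= b} ->
  (Lpnorm r%:E f <= (b * fine (mu [set: T]) `^ r^-1)%:E)%E.
Proof.
move=> b0 fb; rewrite /Lpnorm.
apply: (@le_trans _ _ ('N[mu]_r%:E[EFin \o (fun t : T => b * cst 1 t)%R])%E).
  apply: le_Lnorm_ae => //.
  - exact: measurable_normc_L0.
  - exact: measurable_funM.
  - by move=> t; exact: normc_ge0.
  - by apply: filterS fb => t; rewrite mulr1.
apply: (le_trans (Lnorm_scale mu r1 (f := cst 1%R) _ _ b0)) => //.
have -> : 'N[mu]_r%:E[EFin \o cst 1%R]%E = (mu [set: T] `^ r^-1)%E.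
  by rewrite -(Lnorm_cst1 mu r).
by rewrite EFinM -poweR_EFin fineK// fin_num_measure.
Qed.

End square_integral.

(** * Almost everywhere convergence of fast Cauchy sequences *)
Section fast_convergence.
Context d (T : measurableType d) (R : realType).
Variable mu : {finite_measure set T -> \bar R}.
Implicit Types (f g y : L0 mu) (u : nat -> L0 mu).

Lemma summable_increments_cvg (a w : R^nat) :
  (forall k, `|a k.+1 - a k| <= w k) ->
  (\big[+%E/0%E]_(0 <= k <oo) (w k)%:E < +oo)%E -> cvgn a.
Proof.
move=> aw Sw.
have w0 k : (0 <= (w k)%:E)%E by rewrite lee_fin (le_trans _ (aw k)).
have Sfin : (\big[+%E/0%E]_(0 <= k <oo) (w k)%:E)%E \is a fin_num.
  by rewrite ge0_fin_numE//; apply: nneseries_ge0.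
have cv : cvgn (series (telescope a)).
  apply: normed_cvg; apply: nondecreasing_is_cvgn.
    by apply: nondecreasing_series => n _ _; exact: normr_ge0.
  exists (fine (\big[+%E/0%E]_(0 <= k <oo) (w k)%:E)%E) => _ [n _ <-].
  rewrite -lee_fin fineK//; apply: le_trans (nneseries_lim_ge n _); last first.
    by move=> k _ _; exact: w0.
  by rewrite /= sumEFin lee_fin; apply: ler_sum => k _; exact: aw.
have -> : a = (fun n => series (telescope a) n + a 0%N).
  by apply/funext => n; rewrite telescopeK /= subrK.
by apply: is_cvgD => //; exact: is_cvg_cst.
Qed.

Lemma normr_Re_le (z : R[i]) : `|complex.Re z| <= normc z.
Proof.
case: z => a b; rewrite /normc/= -sqrtr_sqr ler_wsqrtr// lerDl sqr_ge0//.
Qed.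

Lemma normr_Im_le (z : R[i]) : `|complex.Im z| <= normc z.
Proof.
case: z => a b; rewrite /normc/= -sqrtr_sqr ler_wsqrtr// lerDr sqr_ge0//.
Qed.

Lemma normc_le_ReIm (z : R[i]) : normc z <= `|complex.Re z| + `|complex.Im z|.
Proof.
rewrite -(@ler_pXn2r _ 2)// ?nnegrE ?normc_ge0 ?addr_ge0//.
rewrite sqr_normc_ReIm sqrrD !real_normK ?num_real//.
by rewrite addrAC lerDl mulrn_wge0// mulr_ge0.
Qed.

Definition normc_dist f g (t : T) : R := normc (f t - g t).

Lemma measurable_normc_dist f g : measurable_fun [set: T] (normc_dist f g).
Proof.
by apply/measurable_normc/measurable_sub_complex; exact: measurable_L0.
Qed.

Lemma sqint_distE f g : sqint (f - g) = (\int[mu]_t (normc_dist f g t ^+ 2)%:E)%E.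
Proof.
by rewrite (sqint_ae _ (L0_subE f g))//; apply: measurable_sub_complex; exact: measurable_L0.
Qed.

(** From [x <= s * x ^+ 2 + s^-1], which for a suitable [s] does the work of the
    Cauchy-Schwarz inequality. *)
Lemma integral_dist_le f g (s : R) : 0 < s ->
  (\int[mu]_t (normc_dist f g t)%:E <=
   s%:E * sqint (f - g)%R + (s^-1)%:E * mu [set: T])%E.
Proof.
move=> s0; have m1 := measurable_normc_dist f g.
have m2 : measurable_fun [set: T] (fun t => (normc_dist f g t ^+ 2)%:E).
  by apply/measurable_EFinP; exact: measurable_funX.
rewrite sqint_distE -ge0_integralZl_EFin ?(ltW s0)//; last first.
  by move=> t _; rewrite lee_fin sqr_ge0.
rewrite -integral_cst// -ge0_integralD//; last 3 first.
- by move=> t _; rewrite -EFinM lee_fin mulr_ge0 ?sqr_ge0 ?ltW.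
- exact: measurable_funeM.
- by move=> t _; rewrite lee_fin invr_ge0 ltW.
apply: ge0_le_integral => //.
- by move=> t _; rewrite lee_fin normc_ge0.
- exact/measurable_EFinP.
- by apply: emeasurable_funD => //; exact: measurable_funeM.
move=> t _; rewrite -EFinM -EFinD lee_fin.
move: (normc_dist f g t) (normc_ge0 (f t - g t)) => x x0.
rewrite -(ler_pM2l s0) mulrDr divff ?gt_eqF//.
have := sqr_ge0 (s * x - 1); nra.
Qed.

(** With [s = 2 ^ k], the integrals of the increments are summable, so the sum of
    the increments is finite almost everywhere. *)
Lemma fast_ae_cvg u :
  (forall k, (sqint (u k.+1 - u k)%R <= ((8 ^ k)%:R^-1)%:E)%E) ->
  {ae mu, forall t, cvgn (fun k => complex.Re (u k t)) /\
    cvgn (fun k => complex.Im (u k t))}.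
Proof.
move=> ufast; pose w k t := normc_dist (u k.+1) (u k) t.
pose S t := (\big[+%E/0%E]_(0 <= k <oo) (w k t)%:E)%E.
have w0 k t : (0 <= (w k t)%:E)%E by rewrite lee_fin normc_ge0.
have mw k : measurable_fun [set: T] (fun t => (w k t)%:E).
  by apply/measurable_EFinP; exact: measurable_normc_dist.
have mS : measurable_fun [set: T] S.
  by apply: ge0_emeasurable_sum => // k t _ _; exact: w0.
pose m := fine (mu [set: T]).
have mE : mu [set: T] = m%:E by rewrite fineK// fin_num_measure.
have m0 : 0 <= m by rewrite fine_ge0.
have wint k : (\int[mu]_t (w k t)%:E <= ((2 * (1 + m)) / (2 ^ k.+1)%:R)%:E)%E.
  have k0 : 0 < (2 ^ k)%:R :> R by rewrite ltr0n expn_gt0.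
  apply: (le_trans (integral_dist_le _ _ k0)).
  rewrite mE -EFinM; apply: (@le_trans _ _ ((2 ^ k)%:R%:E * ((8 ^ k)%:R^-1)%:E + ((2 ^ k)%:R^-1 * m)%:E)%E).
    by apply: leeD => //; apply: lee_wpmul2l; [rewrite lee_fin ltW|exact: ufast].
  rewrite -EFinM -EFinD lee_fin expnS natrM.
  have -> : 2 * (1 + m) / (2 * (2 ^ k)%:R) = (2 ^ k)%:R^-1 + (2 ^ k)%:R^-1 * m :> R.
    by field; rewrite gt_eqF.
  rewrite lerD2r ler_pdivrMr ?ltr0n ?expn_gt0// mulrC ler_pdivlMr//.
  by rewrite -natrM ler_nat -expnMn; case: (k) => // j; rewrite leq_exp2r.
have Sint : mu.-integrable [set: T] S.
  apply/integrableP; split=> //.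
  have -> : (\int[mu]_t `|S t| = \int[mu]_t S t)%E.
    by apply: eq_integral => t _; rewrite gee0_abs// nneseries_ge0.
  rewrite integral_nneseries//.
  apply: (@le_lt_trans _ _ (2 * (1 + m))%:E); last exact: ltry.
  apply: le_trans (epsilon_trick0 xpredT _); last by rewrite mulr_ge0// addr_ge0.
  by apply: lee_nneseries => // k _ _; apply: integral_ge0 => t _; exact: w0.
have := integrable_ae measurableT Sint.
apply: filterS => t /(_ Logic.I) St.
have Slt : (S t < +oo)%E by rewrite -ge0_fin_numE// nneseries_ge0.
split; apply: (summable_increments_cvg (w := w^~ t)) => // k.
  by apply: le_trans (normr_Re_le _); rewrite raddfB.
by apply: le_trans (normr_Im_le _); rewrite raddfB.
Qed.

(** Upper limits make the limit function measurable without having to discard the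
    points where the sequence diverges. *)
Definition limc u (t : T) : R[i] :=
  (fine (limn_esup (fun k => (complex.Re (u k t))%:E)) +i*
   fine (limn_esup (fun k => (complex.Im (u k t))%:E)))%C.

Lemma measurable_limc u : measurable_fun [set: T] (limc u).
Proof.
have mu_ k := (measurable_complexP _).1 (measurable_L0 (u k)).
apply/measurable_complexP; split.
- apply: (measurableT_comp (fine_measurable measurableT)).
  by apply: measurable_fun_limn_esup => k; apply/measurable_EFinP; exact: (mu_ k).1.
- apply: (measurableT_comp (fine_measurable measurableT)).
  by apply: measurable_fun_limn_esup => k; apply/measurable_EFinP; exact: (mu_ k).2.
Qed.

Lemma limc_cvg u t : cvgn (fun k => complex.Re (u k t)) ->
  cvgn (fun k => complex.Im (u k t)) ->
  normc (u k t - limc u t) @[k --> \oo] --> (0 : R).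
Proof.
move=> cr ci.
have fineE (a : R^nat) : cvgn a -> a n @[n --> \oo] --> fine (limn_esup (fun k => (a k)%:E)).
  move=> ca; have ca' : (a n)%:E @[n --> \oo] --> (limn a)%:E.
    by apply/fine_cvgP; split; [exact: nearW|exact: ca].
  by rewrite (cvg_limn_einf_sup ca').2.
have to0 (a : R^nat) : cvgn a ->
    `|a n - fine (limn_esup (fun k => (a k)%:E))| @[n --> \oo] --> (0 : R).
  move=> /fineE ca; rewrite -[X in _ --> X](normr0 R).
  apply: cvg_norm; rewrite -[X in _ --> X](subrr (fine (limn_esup (fun k => (a k)%:E)))).
  by apply: cvgB => //; exact: cvg_cst.
apply: (squeeze_cvgr (f := fun=> 0) (h := fun k => `|complex.Re (u k t) - complex.Re (limc u t)| +
   `|complex.Im (u k t) - complex.Im (limc u t)|)).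
- apply: nearW => k; rewrite normc_ge0/=.
  by apply: le_trans (normc_le_ReIm _) _; rewrite !raddfB.
- exact: cvg_cst.
- by rewrite -[X in _ --> X](addr0 0); apply: cvgD; [exact: (to0 _ cr)|exact: (to0 _ ci)].
Qed.

End fast_convergence.

(** * Mazur property of L^oo for the norm of L^r *)
Section Lp_real_norms.
Context d (T : measurableType d) (R : realType).
Variable mu : {measure set T -> \bar R}.
Variables (p : \bar R) (p1 : (1 <= p)%E).
Implicit Types f g : Lp mu p1.

Definition rnorm f : R := fine (Lpnorm p f).

Lemma rnormE f : (rnorm f)%:E = Lpnorm p f.
Proof. exact: Lpnorm_fineK. Qed.

Lemma normr_rnorm f : `|f| = (rnorm f)%:C%C.
Proof. by []. Qed.

Lemma rnorm_ge0 f : 0 <= rnorm f.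
Proof. by rewrite fine_ge0// Lpnorm_ge0. Qed.

Lemma rnormD f g : rnorm (f + g) <= rnorm f + rnorm g.
Proof. by have := ler_normD f g; rewrite !normr_rnorm -rmorphD/= lecR. Qed.

Lemma rnormZ (a : R[i]) f : rnorm (a *: f) = normc a * rnorm f.
Proof.
have := normrZ a f; rewrite !normr_rnorm {1}/Num.norm/= -rmorphM/=.
by move=> /(congr1 (@complex.Re R)).
Qed.

Lemma rnorm_eq0 f : rnorm f = 0 -> f = 0.
Proof.
by move=> f0; apply/eqP; rewrite -normr_eq0 normr_rnorm f0.
Qed.

End Lp_real_norms.

Section mazur_Linf.
Context d (T : measurableType d) (R : realType).
Variable mu : {finite_measure set T -> \bar R}.
Variables (r : R) (r1 : (1 <= r%:E)%E).
Notation Linf := (Lp mu (leey 1%E)).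
Implicit Types (f g : Linf).

Lemma Linf_ae f (b : R) : rnorm f <= b -> {ae mu, forall t, normc (f t) <= b}.
Proof. by move=> fb; apply: Linf_normc_le; rewrite -rnormE lee_fin. Qed.

Lemma Linf_in_Lr f : Lp_val f \in in_Lp r1.
Proof.
rewrite unfold_in; apply: le_lt_trans (ltry _).
exact: Lpnorm_le_bound (rnorm_ge0 f) (Linf_ae (lexx _)).
Qed.

Definition Linf_to_Lr f : Lp mu r1 := mkLp (Linf_in_Lr f).

Lemma rnorm_Lr_le f :
  rnorm (Linf_to_Lr f) <= fine (mu [set: T]) `^ r^-1 * rnorm f.
Proof.
rewrite -lee_fin rnormE mulrC.
exact: Lpnorm_le_bound (rnorm_ge0 f) (Linf_ae (lexx _)).
Qed.

Let rsq f : R := fine (sqint f).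

Let rsqE f : (rsq f)%:E = sqint f.
Proof.
rewrite /rsq fineK// ge0_fin_numE; last first.
  by apply: integral_ge0 => t _; rewrite lee_fin sqr_ge0.
apply: le_lt_trans (sqint_le (Linf_ae (lexx (rnorm f)))) _.
by rewrite lte_mul_pinfty ?lee_fin ?sqr_ge0// ltey_eq fin_num_measure.
Qed.

Let rsq_ge0 f : 0 <= rsq f.
Proof. by rewrite fine_ge0// integral_ge0// => t _; rewrite lee_fin sqr_ge0. Qed.

Let rsq_par f g : rsq (f - g) = 2 * rsq f + 2 * rsq g - 4 * rsq (2^-1 *: (f + g)).
Proof.
have : (rsq (f + g) + rsq (f - g))%:E = (2 * rsq f + 2 * rsq g)%:E.
  rewrite !EFinD !EFinM !rsqE; exact: (sqint_parallelogram f g).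
have : (rsq (2^-1 *: (f + g)))%:E = (normc (2^-1 : R[i]) ^+ 2 * rsq (f + g))%:E.
  rewrite EFinM !rsqE; exact: (sqint_scale 2^-1 (f + g)).
rewrite normcV (_ : 2 = (2 : R)%:C%C); last by rewrite rmorphD.
rewrite normc_real ger0_norm// => -[->] [] ?.
have -> : 4 * ((2^-1) ^+ 2 * rsq (f + g)) = rsq (f + g) by field.
lra.
Qed.

(** Dominated convergence yields convergence in L^1, and for functions bounded by
    [c] one has [x `^ r <= c `^ (r - 1) * x]. *)
Lemma Lr_cvg (u : nat -> Linf) (y : L0 mu) (b : R) : 0 <= b ->
  (forall k, rnorm (u k) <= b) -> {ae mu, forall t, normc (y t) <= b} ->
  {ae mu, forall t, normc (u k t - y t) @[k --> \oo] --> (0 : R)} ->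
  forall e : R, 0 < e -> \forall k \near \oo, (Lpnorm r%:E (Lp_val (u k) - y)%R <= e%:E)%E.
Proof.
move=> b0 ub yb uy e e0.
have r0 : 0 < r by rewrite (lt_le_trans ltr01)//.
pose c := b + b + 1.
have c0 : 0 < c by rewrite /c; lra.
have ubd k : {ae mu, forall t, normc_dist (u k) y t <= c}.
  apply: filterS2 (Linf_ae (ub k)) yb => t h1 h2.
  apply: le_trans (normc_le_add _ _) _; rewrite normc_opp /c; lra.
have ubd' : {ae mu, forall t, forall k, normc_dist (u k) y t <= c}.
  by apply/ae_foralln => k; exact: ubd.
have [|||||_ _ cv] := @dominated_convergence _ _ R mu setT measurableT
  (fun k t => (normc_dist (u k) y t)%:E) (cst 0%E) (cst c%:E).
- by move=> k; apply/measurable_EFinP; exact: measurable_normc_dist.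
- by [].
- by apply: filterS uy => t uyt _; apply: cvg_EFin => //; exact: nearW.
- by apply: finite_measure_integrable_cst.
- apply: filterS ubd' => t ct k _.
  by rewrite gee0_abs ?lee_fin ?normc_ge0//; exact: ct.
rewrite integral0 in cv.
pose delta := e `^ r / c `^ (r - 1).
have delta0 : 0 < delta by rewrite divr_gt0// powR_gt0.
move/fine_cvgP: cv => [cfin /cvgr_lt/(_ _ delta0) clt].
near=> k.
have mk := measurable_normc_dist (u k) y.
have Ik : (\int[mu]_t (normc_dist (u k) y t)%:E <= delta%:E)%E.
  rewrite -[leLHS]fineK; last by near: k; exact: cfin.
  by rewrite lee_fin ltW//; near: k; exact: clt.
have -> : Lpnorm r%:E (Lp_val (u k) - y)%R =
    ((\int[mu]_t (normc_dist (u k) y t `^ r)%:E) `^ r^-1)%E.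
  rewrite /Lpnorm unlock; congr (_ `^ _)%E; apply: ae_eq_integral => //.
  - apply/measurable_EFinP; apply: (measurableT_comp (measurable_powR _)).
    by apply: measurableT_comp => //; exact: measurable_normc_L0.
  - by apply/measurable_EFinP; apply: (measurableT_comp (measurable_powR _)).
  apply: filterS (L0_subE (u k) y) => t h tT; rewrite /= h//.
  by rewrite ger0_norm ?normc_ge0.
have -> : e%:E = ((e `^ r)%:E `^ r^-1)%E.
  by rewrite poweR_EFin -powRrM mulfV ?gt_eqF// powRr1// ltW.
have Ige0 : (0 <= \int[mu]_t (normc_dist (u k) y t `^ r)%:E)%E.
  by apply: integral_ge0 => t _; rewrite lee_fin powR_ge0.
apply: gt0_ler_poweR.
- by rewrite invr_ge0 ltW.
- by rewrite in_itv/= leey andbT.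
- by rewrite in_itv/= leey andbT lee_fin powR_ge0.
apply: (@le_trans _ _ ((c `^ (r - 1))%:E * \int[mu]_t (normc_dist (u k) y t)%:E)%E).
  rewrite -ge0_integralZl_EFin ?powR_ge0//; last 2 first.
  - by move=> t _; rewrite lee_fin normc_ge0.
  - exact/measurable_EFinP.
  apply: ae_ge0_le_integral => //.
  - by move=> t _; rewrite lee_fin powR_ge0.
  - by apply/measurable_EFinP; apply: (measurableT_comp (measurable_powR _)).
  - by move=> t _; rewrite -EFinM lee_fin mulr_ge0 ?powR_ge0 ?normc_ge0.
  - by apply: measurable_funeM; exact/measurable_EFinP.
  apply: filterS (ubd k) => t tc _; rewrite -EFinM lee_fin.
  have t0 : 0 <= normc_dist (u k) y t by exact: normc_ge0.
  rewrite -mulr_powRB1// mulrC ler_wpM2r//.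
  by rewrite ge0_ler_powR ?nnegrE// ?subr_ge0 -?lee_fin// lee_fin ltW.
apply: (@le_trans _ _ ((c `^ (r - 1))%:E * delta%:E)%E).
  by apply: lee_wpmul2l => //; rewrite lee_fin powR_ge0.
by rewrite -EFinM lee_fin mulrC divfK// gt_eqF// powR_gt0.
Unshelve. all: by end_near. Qed.

(** The square integral obeys the parallelogram law and is bounded on the balls of
    L^oo, so near-minimisers over the hulls form a fast Cauchy sequence. *)
Lemma Linf_mazur : mazur_property (@rnorm _ T R mu _ (leey 1%E))
  (fun f : Linf => rnorm (Linf_to_Lr f)).
Proof.
move=> b x xb.
have b0 : 0 <= b := le_trans (rnorm_ge0 (x 0%N)) (xb 0%N).
have hull_b y : tail_hull x 0%N y -> rnorm y <= b.
  move=> hy; apply: (hy [set z | rnorm z <= b]) => [z w /= zb wb|m _] //=.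
  rewrite rnormZ normcV (_ : 2 = (2 : R)%:C%C); last by rewrite rmorphD.
  rewrite normc_real ger0_norm// ler_pdivrMl//.
  by apply: le_trans (rnormD _ _) _; lra.
pose m := fine (mu [set: T]).
have mE : mu [set: T] = m%:E by rewrite fineK// fin_num_measure.
(* The factor [8^-1] absorbs the constant of [tail_hull_cauchy]. *)
have [|n|n k nk|u [u_hull u_cauchy]] := @tail_hull_cauchy R Linf rsq rsq_ge0 rsq_par x
  (b ^+ 2 * m) (fun n => 8^-1 * (8 ^ n)%:R^-1).
- move=> y /hull_b yb; rewrite -lee_fin rsqE EFinM -mE.
  exact/sqint_le/Linf_ae.
- by rewrite mulr_gt0// invr_gt0 ltr0n expn_gt0.
- by rewrite ler_pM2l// lef_pV2 ?posrE ?ltr0n ?expn_gt0// ler_nat leq_exp2l.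
have ub k : rnorm (u k) <= b.
  by apply: hull_b; apply: (tail_hull_mono (leq0n k)); exact: u_hull.
have ufast k : (sqint (Lp_val (u k.+1) - Lp_val (u k))%R <= ((8 ^ k)%:R^-1)%:E)%E.
  have -> : Lp_val (u k.+1) - Lp_val (u k) = Lp_val (u k.+1 - u k) by [].
  have := u_cauchy k k.+1 (leqnSn k); rewrite mulrA divff// mul1r.
  have -> : rsq (u k - u k.+1) = rsq (u k.+1 - u k).
    apply: (EFin_inj); rewrite !rsqE.
    have -> : u k - u k.+1 = - 1 *: (u k.+1 - u k) by rewrite scaleN1r opprB.
    rewrite (sqint_scale (- 1) (u k.+1 - u k)) normc_opp normc1 expr1n mul1e//.
  by rewrite -lee_fin rsqE.
have ucvg := fast_ae_cvg ufast.
pose y := toL0 mu (measurable_limc (fun k => Lp_val (u k))).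
have yE := toL0E mu (measurable_limc (fun k => Lp_val (u k))).
have uy : {ae mu, forall t, normc (u k t - y t) @[k --> \oo] --> (0 : R)}.
  apply: filterS2 yE ucvg => t /(_ Logic.I) -> [cr ci].
  exact: limc_cvg.
have yb : {ae mu, forall t, normc (y t) <= b}.
  have uab : {ae mu, forall t, forall k, normc (u k t) <= b}.
    by apply/ae_foralln => k; exact: Linf_ae.
  apply: filterS2 uy uab => t ut tb.
  apply/ler_addgt0Pr => e e0.
  move/cvgr_lt: ut => /(_ _ e0)[k _ /(_ k (leqnn k))/= ke].
  have := normc_le_add (u k t) (- (u k t - y t)).
  rewrite normc_opp opprB addrC subrK; have := tb k; lra.
have y_in : y \in in_Lp (leey 1%E).
  by rewrite unfold_in; apply: le_lt_trans (normc_le_Linf b0 yb) (ltry _).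
exists (mkLp y_in); first by rewrite -lee_fin rnormE; exact: normc_le_Linf.
move=> n e e0; have e20 : 0 < e / 2 by lra.
have [k _ hk] := Lr_cvg b0 ub yb uy e20.
exists (u (maxn n k)).
  by apply: (tail_hull_mono (leq_maxl n k)); exact: u_hull.
apply: (@le_lt_trans _ _ (e / 2)); last by lra.
by rewrite -lee_fin rnormE; apply: hk; exact: leq_maxr.
Qed.

End mazur_Linf.

(** * The two calculi on L^oo and L^r *)
Section bounded_operators_on_Lp.
Context d (T : measurableType d) (R : realType).
Variable mu : {measure set T -> \bar R}.
Variables (p : \bar R) (p1 : (1 <= p)%E).
Notation X := (Lp mu p1).

Lemma rnorm_le_opnorm (A : {linear X -> X}) (c : R) :
  (opnorm A <= c%:E)%E -> forall x, rnorm (A x) <= c * rnorm x.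
Proof.
move=> Ac x; have [x0|x0] := eqVneq (rnorm x) 0.
  by rewrite x0 mulr0 (rnorm_eq0 x0) linear0 -(scale0r (0 : X)) rnormZ normc0 mul0r.
have x_gt0 : 0 < rnorm x by rewrite lt_neqAle eq_sym x0 rnorm_ge0.
have y1 : rnorm ((rnorm x)^-1%:C%C *: x) = 1.
  by rewrite rnormZ normc_real ger0_norm ?invr_ge0 ?ltW// mulVf.
have : ((rnorm (A ((rnorm x)^-1%:C%C *: x)%R))%:E <= c%:E)%E.
  apply: le_trans Ac; apply: ereal_sup_ubound.
  by exists ((rnorm x)^-1%:C%C *: x) => //=; rewrite normr_rnorm y1.
rewrite lee_fin linearZ/= rnormZ normc_real ger0_norm ?invr_ge0 ?(ltW x_gt0)//.
by rewrite ler_pdivrMl// mulrC.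
Qed.

Lemma opnorm_le_rnorm (A : X -> X) (c : R) : 0 <= c ->
  (forall x, rnorm (A x) <= c * rnorm x) -> (opnorm A <= c%:E)%E.
Proof.
move=> c0 Ac; apply: ge_ereal_sup => _ [x /= x1 <-]; rewrite lee_fin.
apply: (le_trans (Ac x)); rewrite -[leRHS]mulr1; apply: ler_wpM2l => //.
by rewrite -lecR.
Qed.

Section bounded_op_of_linear.
Variables (A : X -> X) (A_linear : linear A) (A_bounded : (opnorm A < +oo)%E).

HB.instance Definition _ := GRing.isLinear.Build R[i] X X *:%R A A_linear.

Definition bounded_op_of : bounded_op X := @BoundedOp R X A A_bounded.

End bounded_op_of_linear.

Lemma AC_calculus_bound (sigma : set R) (S : bounded_op X)
    (Phi : (sigma -> R[i]) -> bounded_op X) :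
  sigma !=set0 -> AC_functional_calculus S Phi -> exists2 K : R, 0 <= K &
  forall f, AC f -> forall x, rnorm (Phi f x) <= K * rBV f * rnorm x.
Proof.
move=> sigma0 [_ [K PhiK] _ _]; exists `|K| => // f af.
apply: rnorm_le_opnorm; apply: (le_trans (PhiK f af)).
rewrite BVnormE//; last exact: AC_BV.
by rewrite -EFinM lee_fin ler_wpM2r ?rBV_ge0// ler_norm.
Qed.

End bounded_operators_on_Lp.

Section consistency.
Context d (T : measurableType d) (R : realType).
Variable mu : {finite_measure set T -> \bar R}.
Variables (r : R) (r1 : (1 <= r%:E)%E).
Variable sigma : set R.
Hypothesis sigma0 : sigma !=set0.
Variables (M : R) (sigma_le : forall t : sigma, `|set_val t| <= M).
Variables (S : linear_transformation mu).
Variables (Sr : defines_bounded_op S r1) (Soy : defines_bounded_op S (leey 1%E)).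
Variables (Phir : (sigma -> R[i]) -> bounded_op (Lp mu r1)).
Variables (Phii : (sigma -> R[i]) -> bounded_op (Lp mu (leey 1%E))).
Hypothesis Phir_calculus : AC_functional_calculus (Lp_restriction Sr) Phir.
Hypothesis Phii_calculus : AC_functional_calculus (Lp_restriction Soy) Phii.

Lemma Linf_to_Lr_lin (a : R[i]) (x y : Lp mu (leey 1%E)) :
  Linf_to_Lr r1 (a *: x + y) = a *: Linf_to_Lr r1 x + Linf_to_Lr r1 y.
Proof. exact: val_inj. Qed.

Lemma calculus_cst (p : \bar R) (p1 : (1 <= p)%E) (S' : bounded_op (Lp mu p1))
    (Phi : (sigma -> R[i]) -> bounded_op (Lp mu p1)) (a : R[i]) x :
  AC_functional_calculus S' Phi -> Phi (cst a) x = a *: x.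
Proof.
move=> [[lin _] _ one _].
have a1 := AC_cst sigma0 sigma_le (1 : R[i]).
have -> : (cst a : sigma -> R[i]) = (a - 1) *: cst 1 + cst 1.
  by apply/funext => t; rewrite !fctE /GRing.scale/= mulr1 subrK.
by rewrite lin// !one -{2}[x]scale1r -scalerDl subrK.
Qed.

Lemma calculi_agree_on_poly (p : {poly R[i]}) x :
  Linf_to_Lr r1 (Phii (poly_on p) x) = Phir (poly_on p) (Linf_to_Lr r1 x).
Proof.
have [[linr mulr] _ _ idr] := Phir_calculus.
have [[lini muli] _ _ idi] := Phii_calculus.
have ai : AC (realf id : sigma -> R[i]) := ACr_id sigma0 sigma_le.
elim/poly_ind: p x => [|p a IH] x.
  rewrite poly_onC (calculus_cst _ _ Phii_calculus) (calculus_cst _ _ Phir_calculus).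
  exact: val_inj.
have ap : AC (poly_on p : sigma -> R[i]) := AC_poly sigma0 sigma_le p.
have aa : AC (cst a : sigma -> R[i]) := AC_cst sigma0 sigma_le a.
have api := AC_mul sigma0 sigma_le ap ai.
rewrite -[p * 'X]scale1r poly_on_lin poly_onM poly_onC poly_onX.
rewrite linr// lini// Linf_to_Lr_lin mulr// muli// IH.
rewrite (calculus_cst _ _ Phii_calculus) (calculus_cst _ _ Phir_calculus).
rewrite (idr : forall x, Phir (realf id) x = _) (idi : forall x, Phii (realf id) x = _).
by congr (_ *: Phir _ _ + _); exact: val_inj.
Qed.

(** For polynomials the bound is that of the calculus on L^r; a function of AC is
    approximated by polynomials, the remainder being controlled in L^oo, whose
    norm dominates that of L^r. *)
Lemma Linf_calculus_Lr_bound : exists2 K : R, 0 <= K & forall f, AC f ->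
  forall x, rnorm (Linf_to_Lr r1 (Phii f x)) <=
    K * rBV f * rnorm (Linf_to_Lr r1 x).
Proof.
have [Kr Kr0 hKr] := AC_calculus_bound sigma0 Phir_calculus.
have [Ki Ki0 hKi] := AC_calculus_bound sigma0 Phii_calculus.
have [[lini _] _ _ _] := Phii_calculus.
exists Kr => // f af x; apply/ler_addgt0Pr => e e0.
pose m := fine (mu [set: T]) `^ r^-1.
pose c := m * Ki * rnorm x + Kr * rnorm (Linf_to_Lr r1 x) + 1.
have m0 : 0 <= m := powR_ge0 _ _.
have c1 : 1 <= c by rewrite lerDr addr_ge0// ?mulr_ge0 ?rnorm_ge0.
have c0 : 0 < c by lra.
have [p bp pe] := AC_approx sigma0 af (divr_gt0 e0 c0).
have ap : AC (poly_on p : sigma -> R[i]) := AC_poly sigma0 sigma_le p.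
have afp := AC_sub sigma0 sigma_le af ap.
have -> : Phii f x = 1 *: Phii (f - poly_on p) x + Phii (poly_on p) x.
  by rewrite -lini// scale1r subrK.
rewrite Linf_to_Lr_lin scale1r; apply: le_trans (rnormD _ _) _.
have h1 : rnorm (Linf_to_Lr r1 (Phii (f - poly_on p) x)) <=
    m * Ki * rnorm x * rBV (f - poly_on p).
  apply: le_trans (rnorm_Lr_le r1 _) _; rewrite -/m -!mulrA; apply: ler_wpM2l => //.
  by apply: le_trans (hKi _ afp x) _; rewrite mulrAC mulrA.
have h2 : rnorm (Linf_to_Lr r1 (Phii (poly_on p) x)) <=
    Kr * rnorm (Linf_to_Lr r1 x) * (rBV f + rBV (f - poly_on p)).
  rewrite calculi_agree_on_poly; apply: le_trans (hKr _ ap _) _.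
  rewrite mulrAC; apply: ler_wpM2l; first by rewrite mulr_ge0 ?rnorm_ge0.
  have := (BV_sub sigma0 (AC_BV af) bp).2.
  by rewrite opprB addrC subrK.
apply: le_trans (lerD h1 h2) _.
move: pe; rewrite ltr_pdivlMr// /c.
have := rBV_ge0 sigma0 (f - poly_on p).
lra.
Qed.

End consistency.

Theorem proposition4p5 (R : realType) (d : measure_display)
  (Omega : measurableType d) (mu : {finite_measure set Omega -> \bar R})
  (r : R) (r1 : (1 <= r%:E)%E)
  (sigma : set R) (sigma_neq0 : sigma !=set0) (sigma_compact : compact sigma)
  (T : linear_transformation mu)
  (Tr : defines_bounded_op T r1) (Toy : defines_bounded_op T (leey 1%E)) :
  real_AC_operator sigma (Lp_restriction Tr) ->
  real_AC_operator sigma (Lp_restriction Toy) ->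
  has_BV_functional_calculus sigma (Lp_restriction Toy).
Proof.
move=> [Phir calcr] [Phi calc].
have [M sigma_le] : exists M : R, forall t : sigma, `|set_val t| <= M.
  have [M0 [_ hM]] := compact_bounded sigma_compact.
  exists (M0 + 1) => t; apply: (hM (M0 + 1)); first by rewrite ltrDl.
  exact: set_valP.
have sigma_closed : closed sigma.
  by apply: compact_closed => //; exact: Rhausdorff.
have [K1 K10 PhiN] := Linf_calculus_Lr_bound sigma_neq0 sigma_le calcr calc.
have [K2 K20 PhiB] := AC_calculus_bound sigma_neq0 calc.
pose N (x : Lp mu (leey 1%E)) := rnorm (Linf_to_Lr r1 x).
pose B (x : Lp mu (leey 1%E)) := rnorm x.
have [[lin mul] _ _ _] := calc.
have K0 : 0 <= K1 + K2 by rewrite addr_ge0.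
have [|||||||Psi [Psi_linear Psi_lin Psi_mul Psi_B Psi_AC]] :=
  @BV_extension R sigma sigma_neq0 M sigma_le sigma_closed _ B N _ _ _
    (@Linf_mazur _ _ _ mu r r1) (fun f => bop_fun (Phi f)) (K1 + K2) K0.
- move=> x y; rewrite /N.
  rewrite (_ : Linf_to_Lr r1 (x + y) = Linf_to_Lr r1 x + Linf_to_Lr r1 y).
    exact: rnormD.
  exact: val_inj.
- move=> a x; rewrite /N (_ : Linf_to_Lr r1 (a *: x) = a *: Linf_to_Lr r1 x).
    exact: rnormZ.
  exact: val_inj.
- move=> x /rnorm_eq0 /(congr1 (@Lp_val _ _ _ _ _ _)) x0.
  exact: val_inj.
- exact: lin.
- exact: mul.
- move=> f af x; apply: le_trans (PhiN f af x) _.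
  rewrite -!mulrA; apply: ler_wpM2r; last by rewrite lerDl.
  by rewrite mulr_ge0 ?rBV_ge0 ?rnorm_ge0.
- move=> f af x; apply: le_trans (PhiB f af x) _.
  rewrite -!mulrA; apply: ler_wpM2r; last by rewrite lerDr.
  by rewrite mulr_ge0 ?rBV_ge0 ?rnorm_ge0.
have Psi_bound f : BV f -> forall x, B (Psi f x) <= (K1 + K2) * (2 * rBV f) * B x.
  by move=> bf x; have := Psi_B f x bf; rewrite ger0_norm// rnorm_ge0.
have /choice[Q QE] : forall f, exists S : bounded_op (Lp mu (leey 1%E)),
    BV f -> forall x, S x = Psi f x.
  move=> f; have [bf|nbf] := pselect (BV f); last by exists (Phi f).
  have Psif : (opnorm (Psi f) < +oo)%E.
    apply: le_lt_trans (ltry _); apply: opnorm_le_rnorm (Psi_bound f bf).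
    by rewrite !mulr_ge0// rBV_ge0.
  by exists (bounded_op_of (Psi_linear f) Psif).
exists Phi, Q; split=> //.
- split=> [a f g bf bg x|f g bf bg x].
    by rewrite !QE// ?Psi_lin//; exact: (BV_lin sigma_neq0 a bf bg).1.
  by rewrite !QE// ?Psi_mul//; exact: (BV_mul sigma_neq0 bf bg).1.
- move=> f bf e e0; pose c := 2 * (K1 + K2) + 1.
  have c1 : 1 <= c by rewrite lerDr mulr_ge0.
  have c0 : 0 < c by lra.
  exists (e / c) => [|g bg /(BVnorm_lt sigma_neq0)[bgf]]; first exact: divr_gt0.
  rewrite ltr_pdivlMr// => gfe.
  apply: (@le_lt_trans _ _ ((K1 + K2) * (2 * rBV (g - f)))%:E).
    apply: opnorm_le_rnorm => [|x]; first by rewrite !mulr_ge0// rBV_ge0.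
    have -> : Q g x - Q f x = Psi (g - f) x.
      have -> : g - f = (- 1) *: f + g by rewrite scaleN1r addrC.
      by rewrite Psi_lin// scaleN1r !QE// addrC.
    exact: Psi_bound.
  rewrite lte_fin; apply: le_lt_trans gfe.
  have := rBV_ge0 sigma_neq0 (g - f); rewrite /c; lra.
- by move=> f af x; rewrite QE ?Psi_AC//; exact: AC_BV.
Qed.
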